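(* Let $\Gamma$ be a chain of $g$ loops with admissible edge lengths, let $D$ be a $w_0$-reduced divisor on $\Gamma$ of degree $d$ and rank $r$ whose class is vertex avoiding, and let $m\ge 1$. If $md<2g+4$ then $\{\psi_I : I\subset\{0,\dots,r\}\text{ a multiset with }\#I=m\}$ is tropically independent.
   Context: $\rho(g,r,d)=g-(r+1)(g-d+r)$. Chain of loops: $\Gamma$ is the compact metric graph with vertices $w_0,\dots,w_g$ and $v_1,\dots,v_{g+1}$. For $1\le k\le g$ two edges join $v_k$ and $w_k$, the top edge of length $\ell_k$ and the bottom edge of length $m_k$ (together the $k$th loop). For $0\le k\le g$ an edge (bridge) $\beta_k$ of length $n_k$ joins $w_k$ and $v_{k+1}$. Admissible edge lengths: for all $1\le k\le g$, $4g\,m_k<\ell_k$ and $2m\,\ell_k<\min\{n_{k-1},n_k\}$, and there is no nontrivial relation $c_1m_1+\cdots+c_gm_g=0$ with integers $|c_k|\le g+1$. Divisors: for a piecewise linear function $\psi$ with integer slopes, $\operatorname{div}(\psi)$ has multiplicity at $v$ equal to the sum of incoming slopes of $\psi$ at $v$; $D\sim D'$ if $D'-D=\operatorname{div}(\psi)$ for some $\psi$. Rank is the Baker–Norine rank. A class that contains an effective divisor has a unique $w_0$-reduced representative; it has $d_0$ chips at $w_0$ and at most one chip on each loop. Let $x_i\in\mathbb{R}/(\ell_i+m_i)\mathbb{Z}$ be the distance from $v_i$ to the chip on the $i$th loop in the counterclockwise direction (so starting along the bottom edge) if such a chip exists, and $x_i=0$ otherwise. The associated lingering lattice path in $\mathbb{Z}^r$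 (coordinates numbered $0,\dots,r-1$) is $p_0,\dots,p_g$ with $p_0=(d_0,d_0-1,\dots,d_0-r+1)$ and $p_i-p_{i-1}$ equal to: $(-1,\dots,-1)$ if $x_i=0$; $e_j$ if $x_i=(p_{i-1}(j)+1)m_i$ mod $\ell_i+m_i$ and both $p_{i-1}$ and $p_{i-1}+e_j$ lie in $\mathcal{C}=\{y\in\mathbb{Z}^r: y_0>\cdots>y_{r-1}>0\}$; and $0$ (a lingering step) otherwise. The class of a divisor of rank $r$ and degree $d$ is vertex avoiding if the path has exactly $\rho(g,r,d)$ lingering steps, $x_i\ne m_i$ mod $(\ell_i+m_i)$ for all $i$, and $x_i\ne p_{i-1}(j)m_i$ mod $(\ell_i+m_i)$ for all $i,j$. For such $D$ and $0\le i\le r$ there is a unique $D_i\sim D$ such that $D_i-iw_0-(r-i)v_{g+1}$ is effective. For a multiset $I\subset\{0,\dots,r\}$ of size $m$, $D_I=\sum_{i\in I}D_i$ (with multiplicity) and $\psi_I$ is a piecewise linear function with $mD+\operatorname{div}(\psi_I)=D_I$ (unique up to an additive constant, which does not affect tropical independence). A finite family of piecewise linear functions $\{\phi_t\}$ on $\Gamma$ is tropically dependent if there are real numbers $b_t$ such that at every $v\in\Gamma$ the minimum $\min_t\{\phi_t(v)+b_t\}$ is attained by at least two indices; otherwise tropically independent. *)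

(* Defs.v *)
From HB Require Import structures.
From mathcomp Require Import freeg.
From mathcomp Require Import all_boot all_order all_algebra.
From mathcomp Require Import finmap multiset.
From mathcomp Require Import boolp classical_sets reals topology normedtype.

Set Implicit Arguments.
Unset Strict Implicit.
Unset Printing Implicit Defensive.

Import Order.TTheory GRing.Theory Num.Theory.
Import numFieldNormedType.Exports.

Local Open Scope classical_set_scope.
Local Open Scope ring_scope.

(* A compact metric graph presented by a finite model, self-loops and parallel
   edges allowed. *)
Record mgraph (R : realType) := MGraph {
  vertex : finType;
  edge : finType;
  src : edge -> vertex;
  tgt : edge -> vertex;
  len : edge -> R;
  len_gt0 : forall e, 0 < len e
}.

Section MetricGraph.
Variables (R : realType) (G : mgraph R).

(* [inr (e, t)] is the interior point of the edge [e] at distance [t] from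
   [src e]; every point of the graph has exactly one representation. *)
Definition point : Type :=
  (vertex G + {x : edge G * R | (0 < x.2) && (x.2 < len x.1)})%type.
HB.instance Definition _ := Choice.on point.

(* The point of the closed edge [e] at distance [t] from [src e], with [t]
   clamped to [0, len e]. *)
Definition edge_pt (e : edge G) (t : R) : point :=
  if insub (e, t) is Some x then inr x
  else inl (if t <= 0 then src e else tgt e).

(* A tangent direction at [p] is a pair [(e, b)]: along [e] away from [src e]
   when [b = false], towards [src e] when [b = true].  A self-loop at a vertex
   thus contributes two directions. *)
Definition is_dir (p : point) (d : edge G * bool) : bool :=
  match p with
  | inl v => (if d.2 then tgt d.1 else src d.1) == v
  | inr x => d.1 == (val x).1
  end.

Definition walk (p : point) (d : edge G * bool) (h : R) : point :=
  let t := match p with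
           | inl _ => if d.2 then len d.1 else 0
           | inr x => (val x).2
           end in
  edge_pt d.1 (if d.2 then t - h else t + h).

(* Continuous and affine with integer slope on each closed piece of a finite
   subdivision of [a, b]. *)
Definition pl_on (f : R -> R) (a b : R) : Prop :=
  exists s : seq R, [/\ path <%R a s, last a s = b &
    forall i, (i < size s)%N -> exists c : int, forall t,
      nth b (a :: s) i <= t <= nth b s i ->
      f t = f (nth b (a :: s) i) + c%:~R * (t - nth b (a :: s) i)].

Record plfun := PLFun {
  plfun_val :> point -> R;
  plfunP : forall e, pl_on (fun t => plfun_val (edge_pt e t)) 0 (len e)
}.

(* Slope along [d] in the direction pointing towards [p]. *)
Definition incoming_slope (psi : point -> R) (p : point) (d : edge G * bool)
    : int :=
  xget 0 [set c : int |
    \forall h \near 0^'+, psi (walk p d h) = psi p - c%:~R * h].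

Definition ord_at (psi : point -> R) (p : point) : int :=
  \sum_(d | is_dir p d) incoming_slope psi p d.

Definition divisor := {freeg point}.

Definition effective (D : divisor) : bool := fgle 0 D.

Definition is_div (psi : plfun) (D : divisor) : Prop :=
  forall p, coeff p D = ord_at psi p.

Definition lin_equiv (D D' : divisor) : Prop :=
  exists psi : plfun, is_div psi (D' - D).

Definition rank_ge (D : divisor) (k : nat) : Prop :=
  forall E : divisor, effective E -> deg E = k%:Z ->
    exists2 D', effective D' & lin_equiv (D - E) D'.

(* The Baker-Norine rank of [D] is the nonnegative integer [r]. *)
Definition has_rank (D : divisor) (r : nat) : Prop :=
  rank_ge D r /\ forall k, rank_ge D k -> (k <= r)%N.

(* The topology of the graph is the quotient topology of its closed edges. *)
Definition closed_subset (A : set point) : Prop :=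
  forall e, closed (edge_pt e @^-1` A).

Definition outdeg (A : set point) (p : point) : nat :=
  #|[set d | is_dir p d && `[< \forall h \near 0^'+, ~ A (walk p d h) >]]%SET|.

(* Closed subsets need not be connected here.  Requiring connectedness gives the
   same notion: the components of a closed [A] inherit its outdegrees, and if
   there are infinitely many, then [A] has a boundary point off the finite
   support of [D]. *)
Definition reduced_at (q : point) (D : divisor) : Prop :=
  (forall p, p != q -> 0 <= coeff p D) /\
  forall A : set point, closed_subset A -> A !=set0 -> ~ A q ->
    exists2 p, A p & coeff p D < (outdeg A p)%:Z.

Definition trop_dependent (T : Type) (phi : T -> plfun) : Prop :=
  exists b : T -> R, forall v : point, exists t t' : T, [/\ t <> t',
    (forall s, phi t v + b t <= phi s v + b s) &
    (forall s, phi t' v + b t' <= phi s v + b s)].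

Definition trop_independent (T : Type) (phi : T -> plfun) : Prop :=
  ~ trop_dependent phi.

End MetricGraph.

(* [top_len k], [bot_len k] and [bridge_len k] are l_{k+1}, m_{k+1} and n_k. *)
Record chain_lengths (R : realType) (g : nat) := ChainLengths {
  top_len : 'I_g -> R;
  bot_len : 'I_g -> R;
  bridge_len : 'I_g.+1 -> R;
  top_len_gt0 : forall k, 0 < top_len k;
  bot_len_gt0 : forall k, 0 < bot_len k;
  bridge_len_gt0 : forall k, 0 < bridge_len k
}.

Section ChainOfLoops.
Variables (R : realType) (g : nat) (L : chain_lengths R g).

(* [inl k] is w_k and [inr k] is v_{k+1}. *)
Definition chain_vertex : finType := ('I_g.+1 + 'I_g.+1)%type.

(* [inl (inl k)] and [inl (inr k)] are the top and bottom edges of the (k+1)-st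
   loop, from v_{k+1} to w_{k+1}; [inr k] is the bridge from w_k to v_{k+1}. *)
Definition chain_edge : finType := ('I_g + 'I_g + 'I_g.+1)%type.

Definition chain_src (e : chain_edge) : chain_vertex :=
  match e with
  | inl (inl k) | inl (inr k) => inr (widen_ord (leqnSn g) k)
  | inr k => inl k
  end.

Definition chain_tgt (e : chain_edge) : chain_vertex :=
  match e with
  | inl (inl k) | inl (inr k) => inl (lift ord0 k)
  | inr k => inr k
  end.

Definition chain_len (e : chain_edge) : R :=
  match e with
  | inl (inl k) => top_len L k
  | inl (inr k) => bot_len L k
  | inr k => bridge_len L k
  end.

Lemma chain_len_gt0 e : 0 < chain_len e.
Proof.
by case: e => [[k|k]|k] /=;
  [exact: top_len_gt0|exact: bot_len_gt0|exact: bridge_len_gt0].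
Qed.

Definition chain_of_loops : mgraph R :=
  MGraph chain_src chain_tgt chain_len_gt0.

Definition w_ (k : 'I_g.+1) : point chain_of_loops := inl (inl k).
(* [v_succ k] is v_{k+1}. *)
Definition v_succ (k : 'I_g.+1) : point chain_of_loops := inl (inr k).

Definition admissible (m : nat) : Prop :=
  [/\ forall k, (4 * g)%:R * bot_len L k < top_len L k,
      forall k, (2 * m)%:R * top_len L k <
        Num.min (bridge_len L (widen_ord (leqnSn g) k))
                (bridge_len L (lift ord0 k)) &
      forall c : 'I_g -> int, (forall k, `|c k| <= (g.+1)%:Z) ->
        \sum_k (c k)%:~R * bot_len L k = 0 -> forall k, c k = 0].

Definition loop_len (k : 'I_g) : R := top_len L k + bot_len L k.

(* The point of the loop at counterclockwise distance [x] from its left vertex,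
   for [0 <= x <= loop_len k]: first along the bottom edge, then back along the
   top edge. *)
Definition loop_pt (k : 'I_g) (x : R) : point chain_of_loops :=
  if x <= bot_len L k then edge_pt (G := chain_of_loops) (inl (inr k)) x
  else edge_pt (G := chain_of_loops) (inl (inl k)) (loop_len k - x).

Definition chip_pos (D : divisor chain_of_loops) (k : 'I_g) : R :=
  xget 0 [set x : R | 0 <= x < loop_len k /\ 0 < coeff (loop_pt k x) D].

Definition eqmod_loop (k : 'I_g) (a b : R) : bool :=
  (a - b) / loop_len k \is a Num.int.

Section Path.
Variables (r : nat) (D : divisor chain_of_loops).

Definition in_chamber (y : 'rV[int]_r) : bool :=
  [forall j, 0 < y 0 j] &&
  [forall j : 'I_r, forall j' : 'I_r, (j < j')%N ==> (y 0 j' < y 0 j)].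

Definition can_step (k : 'I_g) (p : 'rV[int]_r) (j : 'I_r) : bool :=
  [&& eqmod_loop k (chip_pos D k) ((p 0 j + 1)%:~R * bot_len L k),
      in_chamber p & in_chamber (p + delta_mx 0 j)].

Definition llp_step (k : 'I_g) (p : 'rV[int]_r) : 'rV[int]_r :=
  if chip_pos D k == 0 then const_mx (-1)
  else if [pick j | can_step k p j] is Some j then delta_mx 0 j
  else 0.

(* Lingering is defined by the case of [llp_step], not by the step being zero:
   the two differ for [r = 0]. *)
Definition lingers (k : 'I_g) (p : 'rV[int]_r) : bool :=
  (chip_pos D k != 0) && ~~ [exists j, can_step k p j].

(* [llp i] is p_i for [i <= g]. *)
Definition llp (i : nat) : 'rV[int]_r :=
  foldl (fun p k => p + llp_step k p)
    (\row_(j < r) (coeff (w_ ord0) D - (j : nat)%:Z)) (take i (enum 'I_g)).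

Definition rho (d : int) : int :=
  g%:Z - (r.+1)%:Z * (g%:Z - d + r%:Z).

(* The class of [D] is vertex avoiding, for [D] its w_0-reduced representative.
   The loop with index [k : 'I_g] joins p_k to p_{k+1}. *)
Definition vertex_avoiding : Prop :=
  [/\ (#|[set k : 'I_g | lingers k (llp k)]%SET|)%:Z = rho (deg D),
      forall k, ~~ eqmod_loop k (chip_pos D k) (bot_len L k) &
      forall k (j : 'I_r),
        ~~ eqmod_loop k (chip_pos D k) ((llp k 0 j)%:~R * bot_len L k)].

End Path.

End ChainOfLoops.

Definition multisets (r m : nat) : Type :=
  {I : {mset 'I_r.+1}%mset | size I == m}.

(* Main.v *)
From Pilot Require Import Defs.
From mathcomp Require Import freeg.
From mathcomp Require Import all_boot all_order all_algebra.
From mathcomp Require Import finmap multiset.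
From mathcomp Require Import boolp classical_sets reals topology normedtype.
From mathcomp Require Import zify ring lra.

Set Implicit Arguments.
Unset Strict Implicit.
Unset Printing Implicit Defensive.

Import Order.TTheory GRing.Theory Num.Theory.
Import numFieldNormedType.Exports.
(* [topology] shadows [point]. *)
Import Pilot.Defs.
Local Open Scope ring_scope.

(**
Let D_i = D + div psi_i. On the bridge from w_k to v_{k+1} the slope of psi_i is
the number of chips that D has, and D_i lacks, to its left; call it s_k(i). Loop
by loop, s_k(i) drops by at least 1 on a loop without chip (unless s_k(i) = 0),
and on a loop with a chip at x it rises by at most 1, and only if x is congruent
to (s_k(i) + 1) m_k. Vertex avoidance then bounds s_k by the lingering lattice
path from above, and counting lingering steps shows that the path ends at
(r, ..., 1), which forces s_k(i) = p_k(i) for i < r and s_k(r) = 0. Hence the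
slopes s_k(i) are distinct for fixed k, the bridges carry no chips of D_i, and at
most one D_i has no chip on a given loop.

Now assume that every point has two minimizers among the psi_I + b_I. Let s_k be
the slope of a minimizer at the middle of the k-th bridge. Cut the graph at these
middles; the piece around the k-th loop gets the number m (chips of D on the
loop) + s_{k-1} - s_k, and the two end pieces get m r - s_0 and s_g. These g + 2
numbers add up to m d. If one of them is at most 1, then near one point of a
bridge of the piece, every minimizer psi_I is such that D_I has at most one chip
there: the bridges are so long compared to the loops that the slopes of psi_I on
both sides are controlled by s_{k-1} and s_k. So I is j, ..., j, i with j the
index without chip, and the minimizers have pairwise distinct slopes on an open
segment, where they cannot be tied at every point. Thus m d >= 2 (g + 2).
*)

(** * Weighted degrees of divisors *)

Section WeightedDegree.
Variables (K : choiceType) (V : zmodType).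
Implicit Types (w : K -> V) (E : {freeg K}).

(** With values in any abelian group, the same sum counts the chips in a region (integer weights)
    and measures the total bend of a function (real weights). *)
Definition wdeg w E : V := \sum_(p <- dom E) w p *~ coeff p E.

Lemma wdegE w E (s : seq K) : uniq s ->
  (forall p, w p *~ coeff p E != 0 -> p \in s) ->
  wdeg w E = \sum_(p <- s) w p *~ coeff p E.
Proof.
move=> us hs; rewrite /wdeg.
rewrite (bigID (fun p => w p *~ coeff p E == 0)) /= big1 ?add0r; last by move=> p /eqP.
rewrite [RHS](bigID (fun p => w p *~ coeff p E == 0)) /= [in RHS]big1 ?add0r; last by move=> p /eqP.
rewrite -[LHS]big_filter -[RHS]big_filter; apply: perm_big; apply: uniq_perm.
- exact/filter_uniq/uniq_dom.
- exact: filter_uniq.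
move=> p; rewrite !mem_filter; case: (boolP (_ == 0)) => //= h.
rewrite (hs _ h) mem_dom; apply: contraNneq h => ->.
by rewrite mulr0z.
Qed.

Lemma wdegB w E F : wdeg w (E - F) = wdeg w E - wdeg w F.
Proof.
pose s := undup (dom E ++ dom F).
have us : uniq s by exact: undup_uniq.
have hs E' : {subset dom E' <= s} -> wdeg w E' = \sum_(p <- s) w p *~ coeff p E'.
  move=> sE; apply: wdegE => // p h; apply: sE; rewrite mem_dom.
  by apply: contraNneq h => ->; rewrite mulr0z.
rewrite (hs E) => [|p pE]; last by rewrite mem_undup mem_cat pE.
rewrite (hs F) => [|p pF]; last by rewrite mem_undup mem_cat pF orbT.
rewrite (hs (E - F)) => [|p /domB]; last by rewrite mem_undup.
by rewrite -sumrB; apply: eq_bigr => p _; rewrite coeffB mulrzBr.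
Qed.

Lemma wdeg0 w : wdeg w 0 = 0.
Proof. by rewrite /wdeg dom0 big_nil. Qed.

Lemma wdegD w E F : wdeg w (E + F) = wdeg w E + wdeg w F.
Proof. by rewrite -[F in LHS]opprK -[- F]sub0r !wdegB wdeg0 sub0r opprK. Qed.

Lemma wdegMn w E n : wdeg w (E *+ n) = wdeg w E *+ n.
Proof. by elim: n => [|n IH]; rewrite ?wdeg0 // !mulrS wdegD IH. Qed.

Lemma wdeg_sum w (I : Type) (s : seq I) (E : I -> {freeg K}) :
  wdeg w (\sum_(i <- s) E i) = \sum_(i <- s) wdeg w (E i).
Proof. by elim: s => [|i s IH]; rewrite ?big_nil ?wdeg0 // !big_cons wdegD IH. Qed.

Lemma eq_wdeg w w' E : (forall p, coeff p E != 0 -> w p = w' p) ->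
  wdeg w E = wdeg w' E.
Proof.
by move=> h; rewrite /wdeg big_seq [RHS]big_seq; apply: eq_bigr => p; rewrite mem_dom => /h->.
Qed.

Lemma wdegDw w w' E : wdeg (fun p => w p + w' p) E = wdeg w E + wdeg w' E.
Proof. by rewrite /wdeg -big_split; apply: eq_bigr => p _; rewrite mulrzDl. Qed.

Lemma wdeg1 w E p : (forall q, q != p -> w q *~ coeff q E = 0) ->
  wdeg w E = w p *~ coeff p E.
Proof.
move=> h; rewrite (@wdegE w E [:: p]) ?big_seq1 //.
by move=> q; rewrite inE; apply: contraNT => /h ->.
Qed.

Lemma wdeg_eq0 w E : (forall q, w q *~ coeff q E = 0) -> wdeg w E = 0.
Proof. by move=> h; apply: big1. Qed.

End WeightedDegree.

Section WeightedDegreeOrder.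
Variables (K : choiceType) (F : numDomainType).
Implicit Types (w : K -> F) (E : {freeg K}).

Lemma ler_wdeg w w' E : (forall p, 0 <= coeff p E) ->
  (forall p, w p <= w' p) -> wdeg w E <= wdeg w' E.
Proof.
move=> hE hw; by apply: ler_sum => p _; apply: ler_wpMz2r.
Qed.

Lemma wdeg_ge0 w E : (forall p, 0 <= coeff p E) ->
  (forall p, 0 <= w p) -> 0 <= wdeg w E.
Proof.
by move=> hE hw; apply: sumr_ge0 => p _; rewrite mulrz_ge0.
Qed.

End WeightedDegreeOrder.

Lemma deg_wdeg (K : choiceType) (E : {freeg K}) : deg E = wdeg (fun=> 1) E.
Proof.
rewrite -[in LHS](freeg_sumE E) /wdeg raddf_sum; apply: eq_bigr => p _.
by rewrite intz; exact: degU.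
Qed.

(** * Piecewise linear functions on an edge *)

Section PiecewiseLinear.
Variable R : realType.
Implicit Types (f : R -> R) (s : seq R) (k : R -> int).

(** Kinks are subtracted, so that [k y] is the drop of the slope at [y], which is the multiplicity
    at [y] of the divisor of the function. *)
Definition kinked (c : int) s k (t : R) : R :=
  c%:~R * t - \sum_(y <- s) (k y)%:~R * Num.max (t - y) 0.

(** Induction on the subdivision: a first piece of slope [c0] in front of a function that starts
    with slope [c1] adds the kink [c0 - c1] at their common point, to the left of all other
    kinks. *)
Lemma pl_on_kinked f (a b : R) : pl_on f a b ->
  exists c s k, [/\ uniq s, {in s, forall y, a < y < b} &
    {in `[a, b], forall t, f t = f a + (kinked c s k t - kinked c s k a)}].
Proof.
case=> u [+ + hu]; elim: u a hu => [|x u IH] a hu /=.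
  move=> _ ->; exists 0, [::], (fun=> 0); split=> // t.
  by rewrite in_itv /= -eq_le => /eqP->; rewrite subrr addr0.
move=> /andP[ax pu] lu.
have [i|c1 [s [k [us sx fk]]]] := IH x _ pu lu.
  by move=> iu; case: (hu i.+1 iu) => c hc; exists c.
have xb : x <= b.
  have := lu; rewrite -nth_last => <-.
  have := pu; rewrite lt_path_sortedE => /andP[/allP hx _].
  by case: u {IH hu pu lu sx fk} hx => //= y u hx; apply/ltW/hx/mem_nth.
have [c0 /= hc0] := hu 0 isT.
have [xb'|xb'] := eqVneq x b.
  exists c0, [::], (fun=> 0); split=> // t; rewrite in_itv /= -xb' => tax.
  by rewrite (hc0 t) // /kinked !big_nil; ring.
have {xb xb'}xb : x < b by rewrite lt_neqAle xb' xb.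
pose k' y := if y == x then c0 - c1 else k y.
have kk' : {in s, k =1 k'}.
  by move=> y ys; rewrite /k'; case: eqP => // yx; have := sx y ys; rewrite yx ltxx.
have ks t : \sum_(y <- s) (k' y)%:~R * Num.max (t - y) 0 =
            \sum_(y <- s) (k y)%:~R * Num.max (t - y) 0 :> R.
  by apply: eq_big_seq => y /kk'->.
have z t : t <= x -> \sum_(y <- s) (k y)%:~R * Num.max (t - y) 0 = 0 :> R.
  move=> tx; rewrite big_seq big1 // => y /sx/andP[xy _].
  by rewrite max_r ?mulr0 //; lra.
exists c0, (x :: s), k'; split.
- by rewrite /= us andbT; apply/negP => /sx; rewrite ltxx.
- move=> y; rewrite inE => /predU1P[->|/sx/andP[xy ->]]; first by rewrite ax.
  by rewrite (lt_trans ax xy).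
move=> t; rewrite in_itv /= => /andP[a_t tb].
rewrite /kinked !big_cons !ks (z a (ltW ax)) /k' eqxx.
rewrite (max_r (_ : a - x <= 0)) ?subr_le0 ?(ltW ax) //.
have [tx|tx] := leP t x.
  rewrite (hc0 t) ?a_t //  (z t tx) max_r ?subr_le0 //; ring.
rewrite fk ?in_itv /= ?(ltW tx) // (hc0 x) ?lexx ?(ltW ax) // /kinked (z x) //.
rewrite max_l ?subr_ge0 ?(ltW tx) // rmorphB /=; ring.
Qed.

(** The slope to the right of [t] has passed the kink at [t], the slope to its left has not. This
    difference between [y <= t] here and [y < t] in [kinked_left] later yields the coefficient at
    [t]. *)
Lemma kinked_right c s k (t : R) : exists2 e : R, 0 < e &
  forall h, 0 < h < e -> kinked c s k (t + h) =
    kinked c s k t + (c - \sum_(y <- s | y <= t) k y)%:~R * h.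
Proof.
rewrite /kinked; elim: s => [|y s [e e0 he]].
  by exists 1 => // h _; rewrite !big_nil; ring.
have [yt|ty] := leP y t.
  exists e => // h he'; have := he h he'; rewrite !big_cons yt.
  move: he' => /andP[h0 _].
  rewrite !max_l ?rmorphB ?rmorphD /=; [|lra|lra].
  by rewrite !mulrDl => E; lra.
exists (Num.min e (y - t)); first by rewrite lt_min e0 subr_gt0.
move=> h; rewrite lt_min => /and3P[h0 he' hy].
have := he h; rewrite h0 he' => /(_ isT); rewrite !big_cons leNgt ty /=.
by rewrite !max_r ?mulr0 ?add0r //; lra.
Qed.

Lemma kinked_left c s k (t : R) : exists2 e : R, 0 < e &
  forall h, 0 < h < e -> kinked c s k (t - h) =
    kinked c s k t - (c - \sum_(y <- s | y < t) k y)%:~R * h.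
Proof.
rewrite /kinked; elim: s => [|y s [e e0 he]].
  by exists 1 => // h _; rewrite !big_nil; ring.
have [yt|ty] := ltP y t.
  exists (Num.min e (t - y)); first by rewrite lt_min e0 subr_gt0.
  move=> h; rewrite lt_min => /and3P[h0 he' hy].
  have := he h; rewrite h0 he' => /(_ isT); rewrite !big_cons yt.
  rewrite !max_l ?rmorphB ?rmorphD /=; [|lra|lra].
  by rewrite !mulrDl => E; lra.
exists e => // h he'; have := he h he'; rewrite !big_cons ltNge ty /=.
move: he' => /andP[h0 _].
by rewrite !max_r ?mulr0 ?add0r //; lra.
Qed.

End PiecewiseLinear.

(** * Slopes along edges and multiplicities of principal divisors *)

Section EdgeFormula.
Local Open Scope classical_set_scope.
Variables (R : realType) (G : mgraph R).
Implicit Types (psi : plfun G) (E : divisor G) (e : edge G).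

Lemma edge_pt_in e t (h : (0 < t) && (t < len e)) :
  edge_pt e t = inr (exist _ (e, t) h).
Proof. by rewrite /edge_pt insubT. Qed.

Lemma edge_pt_src e t : t <= 0 -> edge_pt e t = inl (src e).
Proof.
by move=> t0; rewrite /edge_pt insubF ?t0 //=; rewrite ltNge t0.
Qed.

Lemma edge_pt_tgt e t : len e <= t -> edge_pt e t = inl (tgt e).
Proof.
move=> t0; rewrite /edge_pt insubF /=; last by rewrite [t < _]ltNge t0 andbF.
by rewrite leNgt (lt_le_trans (len_gt0 e) t0).
Qed.

(** Two integers that both fit for all small [h > 0] agree, so the choice made by [xget] is
    forced. *)
Lemma incoming_slopeE psi p d (c : int) :
  (exists2 e : R, 0 < e &
    forall h, 0 < h < e -> psi (walk p d h) = psi p - c%:~R * h) ->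
  incoming_slope psi p d = c.
Proof.
case=> e e0 he.
have near_c : \forall h \near 0^'+, psi (walk p d h) = psi p - c%:~R * h.
  near=> h; apply: he; apply/andP; split; near: h.
    exact: nbhs_right_gt.
  exact: nbhs_right_lt.
apply: xget_unique => // c' /= near_c'; near (0 : R)^'+ => h.
have h0 : 0 < h by near: h; exact: nbhs_right_gt.
have E1 : psi (walk p d h) = psi p - c%:~R * h by near: h.
have E2 : psi (walk p d h) = psi p - c'%:~R * h by near: h.
have : (c' - c)%:~R * h == 0 by rewrite rmorphB /=; apply/eqP; lra.
by rewrite mulf_eq0 (gt_eqF h0) orbF intr_eq0 subr_eq0 => /eqP.
Unshelve. all: by end_near.
Qed.

Definition on_edge e (p : point G) : int :=
  if p is inr x then ((val x).1 == e)%:Z else 0.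

(** As a weight, it measures how far the chips inside [e] pull a function at distance [t] below the
    line given by its initial slope. *)
Definition edge_kink e (t : R) (p : point G) : R :=
  if p is inr x then
    if (val x).1 == e then Num.max (t - (val x).2) 0 else 0
  else 0.

Lemma ord_at_interior psi (x : {x : edge G * R | (0 < x.2) && (x.2 < len x.1)}) :
  ord_at psi (inr x) = incoming_slope psi (inr x) ((val x).1, false) +
                       incoming_slope psi (inr x) ((val x).1, true).
Proof.
rewrite /ord_at (eq_bigl (fun d => (d == ((val x).1, false)) || (d == ((val x).1, true)))).
  rewrite (bigD1 ((val x).1, false)) ?eqxx //=; congr (_ + _).
  rewrite (big_pred1 ((val x).1, true)) // => -[e b] /=.
  by rewrite !xpair_eqE; case: b; case: eqVneq.
by move=> [e b] /=; rewrite !xpair_eqE; case: b; case: eqVneq.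
Qed.

(** The multiplicity at an interior point is the drop of the slope there, so the chips of [E] inside
    [e] are exactly the kinks of [psi] on [e]. The initial slope and [E] then determine [psi] on [e]
    and its slope at the far end. *)
Lemma plfun_edge psi E e : is_div psi E -> exists c : int,
  [/\ forall t, 0 <= t <= len e -> psi (edge_pt e t) =
         psi (inl (src e)) + c%:~R * t - wdeg (edge_kink e t) E,
      incoming_slope psi (inl (src e)) (e, false) = - c &
      incoming_slope psi (inl (tgt e)) (e, true) = c - wdeg (on_edge e) E].
Proof.
move=> psiE; have L0 := len_gt0 e.
have [c [s [k [us sL fk]]]] := pl_on_kinked (plfunP psi e).
have fk0 t : 0 <= t <= len e ->
    psi (edge_pt e t) = psi (inl (src e)) + kinked c s k t.
  move=> ht; rewrite fk ?in_itv //= edge_pt_src //; congr (_ + _).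
  rewrite -[RHS]subr0; congr (_ - _); rewrite /kinked mulr0 big_seq.
  rewrite big1 ?subrr // => y /sL/andP[y0 _].
  by rewrite max_r ?mulr0 //; lra.
have coeffE (y : R) : 0 < y < len e ->
    coeff (edge_pt e y) E = if y \in s then k y else 0.
  move=> hy; rewrite psiE (edge_pt_in hy) ord_at_interior /=.
  have [d1 d10 hd1] := kinked_right c s k y.
  have [d2 d20 hd2] := kinked_left c s k y.
  rewrite (@incoming_slopeE psi _ _ (- (c - \sum_(z <- s | z <= y) k z))); last first.
    exists (Num.min d1 (len e - y)); first by rewrite lt_min d10 subr_gt0 (andP hy).2.
    move=> h; rewrite lt_min => /and3P[h0 hd hL]; rewrite /walk /= -(edge_pt_in hy).
    rewrite !fk0; [|lra|lra].
    by rewrite hd1 ?h0 // rmorphN /=; ring.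
  rewrite (@incoming_slopeE psi _ _ (c - \sum_(z <- s | z < y) k z)); last first.
    exists (Num.min d2 y); first by rewrite lt_min d20 (andP hy).1.
    move=> h; rewrite lt_min => /and3P[h0 hd hL]; rewrite /walk /= -(edge_pt_in hy).
    rewrite !fk0; [|lra|lra].
    by rewrite hd2 ?h0 //; ring.
  (* The sums over [z <= y] and over [z < y] differ only in the kink at [y]. *)
  rewrite opprB addrA subrK.
  rewrite (bigID (fun z => z == y)) /= [X in _ + X - _](eq_bigl (fun z => z < y)); last first.
    by move=> z; rewrite lt_neqAle andbC.
  rewrite addrK (eq_bigl (pred1 y)); last first.
    by move=> z /=; case: eqVneq => [->|]; rewrite ?lexx ?andbF.
  case: ifPn => ys.
    by rewrite big_mkcond (bigD1_seq y) //= eqxx big1 ?addr0 // => z /negbTE ->.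
  by rewrite big_seq_cond big1 // => z /andP[zs /eqP zy]; rewrite -zy zs in ys.
have wE (V : zmodType) (w : point G -> V) :
    (forall p, w p != 0 -> exists2 y : R, 0 < y < len e & p = edge_pt e y) ->
    wdeg w E = \sum_(y <- s) w (edge_pt e y) *~ k y.
  move=> hw; rewrite (@wdegE _ _ w E (map (edge_pt e) s)).
  - rewrite big_map [LHS]big_seq [RHS]big_seq; apply: eq_bigr => y ys.
    by rewrite coeffE ?sL // ys.
  - rewrite map_inj_in_uniq // => y z /sL hy /sL hz.
    by rewrite (edge_pt_in hy) (edge_pt_in hz) => -[].
  - move=> p hp; have [|y hy py] := hw p.
      by apply: contraNneq hp => ->; rewrite mul0rz.
    rewrite py map_f //; apply: contraNT hp => ys.
    by rewrite py coeffE // (negbTE ys) mulr0z.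
have wE' (V : zmodType) (w : point G -> V) :
    (forall v, w (inl v) = 0) -> (forall x, (val x).1 != e -> w (inr x) = 0) ->
    wdeg w E = \sum_(y <- s) w (edge_pt e y) *~ k y.
  move=> w0 w1; apply: wE => -[v|x]; first by rewrite w0 eqxx.
  case: (eqVneq (val x).1 e) => [xe _|/w1->]; last by rewrite eqxx.
  case: x xe => -[e' y] /= hy xe; subst e'; exists y => //.
  by rewrite edge_pt_in.
exists c; split.
- move=> t ht; rewrite fk0 // /kinked addrA; congr (_ - _).
  rewrite (wE' _ (edge_kink e t)) => [|//|x /negbTE /= ->] //.
  rewrite [LHS]big_seq [RHS]big_seq; apply: eq_bigr => y /sL hy.
  by rewrite (edge_pt_in hy) /= eqxx mulrzl.
- apply: incoming_slopeE; have [d d0 hd] := kinked_right c s k 0.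
  exists (Num.min d (len e)); first by rewrite lt_min d0 len_gt0.
  move=> h; rewrite lt_min => /and3P[h0 hd' hL]; rewrite /walk /=.
  have := fk0 0; rewrite lexx ltW // => /(_ isT); rewrite edge_pt_src // => E0.
  rewrite fk0; last lra.
  rewrite hd ?h0 // big_seq_cond big1 ?subr0 ?rmorphN /=; first by lra.
  by move=> y /andP[/sL ? ?]; exfalso; lra.
- apply: incoming_slopeE; have [d d0 hd] := kinked_left c s k (len e).
  exists (Num.min d (len e)); first by rewrite lt_min d0 len_gt0.
  move=> h; rewrite lt_min => /and3P[h0 hd' hL]; rewrite /walk /=.
  have := fk0 (len e); rewrite lexx ltW // => /(_ isT); rewrite edge_pt_tgt // => E0.
  rewrite fk0; last lra.
  rewrite hd ?h0 // wE' //; last by move=> x /negbTE /= ->.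
  rewrite (_ : \sum_(y <- s) _ = \sum_(y <- s | y < len e) k y); first by lra.
  rewrite [RHS]big_seq_cond [LHS]big_seq [LHS](eq_bigl (fun y => (y \in s) && (y < len e))).
    by apply: eq_bigr => y /andP[/sL hy _]; rewrite (edge_pt_in hy) /= eqxx intz.
  by move=> y; case: (boolP (y \in s)) => // /sL /andP[_ ->].
Qed.

Lemma plfun_edges psi E : is_div psi E -> exists c : edge G -> int,
  (forall e t, 0 <= t <= len e -> psi (edge_pt e t) =
     psi (inl (src e)) + (c e)%:~R * t - wdeg (edge_kink e t) E) /\
  (forall v, coeff (inl v) E =
     \sum_(e | tgt e == v) (c e - wdeg (on_edge e) E) - \sum_(e | src e == v) c e).
Proof.
move=> psiE; have /choice[c hc] e := plfun_edge e psiE.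
exists c; split=> [e t ht|v]; first by have [-> //] := hc e.
rewrite psiE /ord_at (eq_bigr (fun d => incoming_slope psi (inl v) (d.1, d.2))); last by case.
rewrite -(pair_big_dep xpredT (fun e b => is_dir (inl v) (e, b))
   (fun e b => incoming_slope psi (inl v) (e, b))) /=.
rewrite (eq_bigr (fun e => (if tgt e == v then c e - wdeg (on_edge e) E else 0)
     - (if src e == v then c e else 0))).
  by rewrite sumrB -!big_mkcond.
move=> e _; have [_ h1 h2] := hc e; rewrite big_mkcond big_bool /=.
have h1' : src e = v -> incoming_slope psi (inl v) (e, false) = - c e by move=> <-.
have h2' : tgt e = v ->
    incoming_slope psi (inl v) (e, true) = c e - wdeg (on_edge e) E by move=> <-.
by case: eqP => [/h2'->|_]; case: eqP => [/h1'->|_]; rewrite ?subr0 ?sub0r ?addr0.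
Qed.

End EdgeFormula.

(** * Slopes on the chain of loops *)

Section ChainFlow.
Variables (R : realType) (g : nat) (L : chain_lengths R g).
Local Notation C := (chain_of_loops L).
Implicit Types (psi : plfun C) (E : divisor C).

Definition top (k : 'I_g) : edge C := inl (inl k).
Definition bot (k : 'I_g) : edge C := inl (inr k).
Definition bridge (k : 'I_g.+1) : edge C := inr k.

(* Zones are numbered from left to right: w_0, then alternately the interior of
   a bridge (odd) and a closed loop (even), and finally v_{g+1}. *)
Definition zone (p : point C) : nat :=
  match p with
  | inl (inl k) => 2 * k
  | inl (inr k) => 2 * k + 2
  | inr x => match (val x).1 with
             | inl (inl k) | inl (inr k) => 2 * k + 2
             | inr k => 2 * k + 1
             end
  end.

Definition zdeg (n : nat) E : int := wdeg (fun p => (zone p == n)%:Z) E.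
(** For a principal divisor and [n = 2 * k], minus this number is the slope with which the function
    enters the bridge from [w_k]. *)
Definition ldeg (n : nat) E : int := wdeg (fun p => (zone p <= n)%N%:Z) E.

Lemma ldegS n E : ldeg n.+1 E = ldeg n E + zdeg n.+1 E.
Proof.
rewrite /ldeg /zdeg -wdegDw; apply: eq_wdeg => p _.
by rewrite leq_eqVlt ltnS; case: eqVneq => [->|_]; rewrite ?ltnn ?addr0.
Qed.

Lemma ldeg_bridge (k : nat) E : ldeg (2 * k + 1) E = ldeg (2 * k) E + zdeg (2 * k + 1) E.
Proof. by rewrite addn1 ldegS. Qed.

Lemma ldeg_loop (k : nat) E :
  ldeg (2 * k.+1) E = ldeg (2 * k + 1) E + zdeg (2 * k + 2) E.
Proof. by rewrite (_ : 2 * k.+1 = (2 * k + 1).+1)%N ?ldegS ?addn1 ?addn2 //; lia. Qed.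

Lemma zdeg0 E : zdeg 0 E = coeff (w_ L ord0) E.
Proof.
rewrite /zdeg (@wdeg1 _ _ _ _ (w_ L ord0)) /= ?muln0 ?eqxx ?intz // => q qw.
suff -> : zone q == 0%N = false by rewrite mul0rz.
case: q qw => [[k|k]|[[[[k|k]|k] t] h]] /=; rewrite ?addn1 ?addn2 //.
move=> kw; apply: contraNF kw => /eqP k0; apply/eqP; congr (inl (inl _)).
by apply: val_inj => /=; lia.
Qed.

Lemma ldeg0 E : ldeg 0 E = coeff (w_ L ord0) E.
Proof. by rewrite -zdeg0; apply: eq_wdeg => p _; rewrite leqn0. Qed.

Lemma zone_le p : (zone p <= 2 * g + 2)%N.
Proof.
by case: p => [[k|k]|[[[[k|k]|k] t] h]] /=; have := ltn_ord k; lia.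
Qed.

Lemma deg_ldeg E : deg E = ldeg (2 * g.+1) E.
Proof.
rewrite deg_wdeg; apply: eq_wdeg => p _.
by have := zone_le p; rewrite mulnS addnC => ->.
Qed.

Lemma zdeg_bridge (k : 'I_g.+1) E : zdeg (2 * k + 1) E = wdeg (on_edge (bridge k)) E.
Proof.
apply: eq_wdeg => -[[j|j]|[[[[j|j]|j] t] h]] _ /=.
- by rewrite (_ : (_ == _) = false) //; lia.
- by rewrite (_ : (_ == _) = false) //; lia.
- by rewrite (_ : (_ == _)%N = false) //; lia.
- by rewrite (_ : (_ == _)%N = false) //; lia.
congr (nat_of_bool _)%:Z; rewrite -[RHS]/(j == k) -val_eqE /=; lia.
Qed.

Definition at_point (q p : point C) : int := (p == q)%:Z.

Lemma wdeg_at_point q E : wdeg (at_point q) E = coeff q E.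
Proof.
rewrite (@wdeg1 _ _ _ _ q) /at_point ?eqxx ?intz // => p /negbTE ->.
by rewrite mul0rz.
Qed.

Lemma eq_w (p : point C) k :
  (p == w_ L k) = if p is inl (inl j) then j == k else false.
Proof. by case: p => [[j|j]|x]. Qed.

Lemma eq_v_succ (p : point C) k :
  (p == v_succ L k) = if p is inl (inr j) then j == k else false.
Proof. by case: p => [[j|j]|x]. Qed.

Lemma eq_top (e : edge C) k : (e == top k) = if e is inl (inl j) then j == k else false.
Proof. by case: e => [[j|j]|j]. Qed.

Lemma eq_bot (e : edge C) k : (e == bot k) = if e is inl (inr j) then j == k else false.
Proof. by case: e => [[j|j]|j]. Qed.

Lemma eq_bridge (e : edge C) k : (e == bridge k) = if e is inr j then j == k else false.
Proof. by case: e => [[j|j]|j]. Qed.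

Lemma zdeg_loop (k : 'I_g) E : zdeg (2 * k + 2) E =
  coeff (v_succ L (widen_ord (leqnSn g) k)) E + coeff (w_ L (lift ord0 k)) E +
  (wdeg (on_edge (top k)) E + wdeg (on_edge (bot k)) E).
Proof.
rewrite -!wdeg_at_point -!wdegDw; apply: eq_wdeg => p _.
rewrite /at_point /zone eq_w eq_v_succ.
case: p => [[j|j]|[[e t] h]]; rewrite /on_edge ?eq_top ?eq_bot.
- by rewrite -val_eqE /= /bump !addr0 add0r; congr (nat_of_bool _)%:Z; lia.
- by rewrite -val_eqE /= !addr0; congr (nat_of_bool _)%:Z; lia.
rewrite !add0r /=; case: e h => [[j|j]|j] h; rewrite -?val_eqE /= ?addr0 ?add0r.
- by congr (nat_of_bool _)%:Z; lia.
- by congr (nat_of_bool _)%:Z; lia.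
- by rewrite (_ : (_ == _)%N = false) //; lia.
Qed.

Lemma zdeg_last E : zdeg (2 * g + 2) E = coeff (v_succ L ord_max) E.
Proof.
rewrite -!wdeg_at_point; apply: eq_wdeg => p _; rewrite /at_point eq_v_succ.
case: p => [[j|j]|[[[[j|j]|j] t] h]] /=; have := ltn_ord j => ?.
- by rewrite (_ : (_ == _)%N = false) //; lia.
- by rewrite -val_eqE /=; congr (nat_of_bool _)%:Z; lia.
all: by rewrite (_ : (_ == _)%N = false) //; lia.
Qed.

Section VertexSums.
Variable F : edge C -> int.

Lemma sum_chain_edge (P : pred (edge C)) : \sum_(e | P e) F e =
  \sum_(k | P (top k)) F (top k) + \sum_(k | P (bot k)) F (bot k) +
  \sum_(k | P (bridge k)) F (bridge k).
Proof.
rewrite -[LHS]/(\sum_(e : chain_edge g | P e) F e).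
by rewrite (big_sumType _ P F) (big_sumType _ (P \o inl) (F \o inl)).
Qed.

Lemma sum_tgt_w k : \sum_(e : edge C | tgt e == inl (lift ord0 k)) F e = F (top k) + F (bot k).
Proof.
rewrite (sum_chain_edge (fun e => tgt e == _)) [X in _ + X]big_pred0 // addr0.
by congr (_ + _); apply: big_pred1 => j;
  rewrite -[LHS]/(lift ord0 j == lift ord0 k) (inj_eq lift_inj).
Qed.

Lemma sum_tgt_w0 : \sum_(e : edge C | tgt e == inl (ord0 : 'I_g.+1)) F e = 0.
Proof. by rewrite (sum_chain_edge (fun e => tgt e == _)) !big_pred0 ?addr0. Qed.

Lemma sum_src_w k : \sum_(e : edge C | src e == inl k) F e = F (bridge k).
Proof.
rewrite (sum_chain_edge (fun e => src e == _)) [X in X + _ + _]big_pred0 //.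
rewrite [X in _ + X + _]big_pred0 // !add0r.
by apply: big_pred1 => j; rewrite -[LHS]/(j == k).
Qed.

Lemma sum_tgt_v k : \sum_(e : edge C | tgt e == inr k) F e = F (bridge k).
Proof.
rewrite (sum_chain_edge (fun e => tgt e == _)) [X in X + _ + _]big_pred0 //.
rewrite [X in _ + X + _]big_pred0 // !add0r.
by apply: big_pred1 => j; rewrite -[LHS]/(j == k).
Qed.

Lemma sum_src_v k :
  \sum_(e : edge C | src e == inr (widen_ord (leqnSn g) k)) F e = F (top k) + F (bot k).
Proof.
rewrite (sum_chain_edge (fun e => src e == _)) [X in _ + X]big_pred0 // addr0.
by congr (_ + _); apply: big_pred1 => j;
  rewrite -[LHS]/(widen_ord _ j == widen_ord _ k) -!val_eqE.
Qed.

Lemma sum_src_v_last : \sum_(e : edge C | src e == inr (ord_max : 'I_g.+1)) F e = 0.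
Proof.
rewrite (sum_chain_edge (fun e => src e == _)) !big_pred0 ?addr0 // => j.
  by rewrite -[LHS]/(widen_ord _ j == ord_max) -val_eqE /= ltn_eqF.
by rewrite -[LHS]/(widen_ord _ j == ord_max) -val_eqE /= ltn_eqF.
Qed.

End VertexSums.

(** Adding up multiplicities from [w_0] to the right, the slopes at inner ends cancel, and the flow
    across a cut is minus the number of chips to its left. No edge leaves [v_{g+1}], which closes
    the sum and gives degree 0. *)
Lemma chain_flow psi E : is_div psi E -> exists c : edge C -> int,
  [/\ forall e t, 0 <= t <= len e -> psi (edge_pt e t) =
        psi (inl (src e)) + (c e)%:~R * t - wdeg (edge_kink e t) E,
      forall k, c (bridge k) = - ldeg (2 * k) E,
      forall k, c (bot k) + c (top k) =
        - ldeg (2 * k + 1) E - coeff (v_succ L (widen_ord (leqnSn g) k)) E &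
      deg E = 0].
Proof.
move=> psiE; have [c [cedge cvert]] := plfun_edges psiE.
have V (k : 'I_g) : c (bot k) + c (top k) =
    c (bridge (widen_ord (leqnSn g) k)) - zdeg (2 * k + 1) E
    - coeff (v_succ L (widen_ord (leqnSn g) k)) E.
  have := zdeg_bridge (widen_ord (leqnSn g) k) E.
  by rewrite cvert sum_src_v sum_tgt_v /= => ->; lia.
have W (k : 'I_g) : c (bridge (lift ord0 k)) =
    c (bot k) + c (top k) - (wdeg (on_edge (top k)) E + wdeg (on_edge (bot k)) E)
    - coeff (w_ L (lift ord0 k)) E.
  by rewrite cvert sum_src_w sum_tgt_w; lia.
(* Induction along the chain: [V] passes a bridge and its right end, [W] passes a loop and its right
   vertex. *)
have B (k : 'I_g.+1) : c (bridge k) = - ldeg (2 * k) E.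
  case: k => k; elim: k => [|k IH] kg.
    rewrite (_ : Ordinal kg = ord0); last exact: val_inj.
    by rewrite muln0 ldeg0 cvert sum_src_w sum_tgt_w0; lia.
  have IH' := IH (ltnW kg).
  pose k0 : 'I_g := Ordinal (kg : (k < g)%N).
  have e1 : lift ord0 k0 = Ordinal kg by apply: val_inj.
  have e2 : widen_ord (leqnSn g) k0 = Ordinal (ltnW kg) by apply: val_inj.
  have := W k0; have := V k0; rewrite e1 e2 IH' => -> ->.
  by rewrite -[nat_of_ord (Ordinal kg)]/k.+1 ldeg_loop ldeg_bridge (zdeg_loop k0) e1 e2
    -[nat_of_ord k0]/k -[nat_of_ord (Ordinal (ltnW kg))]/k; lia.
exists c; split; [exact: cedge|exact: B|move=> k|].
  by rewrite V B ldeg_bridge -[nat_of_ord (widen_ord _ k)]/(nat_of_ord k); lia.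
rewrite deg_ldeg ldeg_loop ldeg_bridge zdeg_last.
rewrite cvert sum_src_v_last sum_tgt_v.
by have := B ord_max; have := zdeg_bridge ord_max E; rewrite -[nat_of_ord ord_max]/g => -> ->; lia.
Qed.

End ChainFlow.

(** * Reduced divisors *)

Section Firing.
Variables (R : realType) (G : mgraph R).
Implicit Types (A : set (point G)) (D : divisor G).
Local Open Scope classical_set_scope.

(** [B p] only has to contain the directions that leave [A] at [p], so that outdegrees are bounded
    without being computed. *)
Lemma reduced_fire q D A (B : point G -> {set edge G * bool}) :
  reduced_at q D -> closed_subset A -> A !=set0 -> ~ A q ->
  (forall p d, A p -> is_dir p d -> d \notin B p -> exists2 e : R, 0 < e &
     forall h, 0 < h < e -> A (walk p d h)) ->
  exists2 p, A p & coeff p D < #|B p|%:Z.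
Proof.
move=> [_ red] clA A0 Aq good; have [p Ap lt_p] := red A clA A0 Aq.
exists p => //; apply: lt_le_trans lt_p _; rewrite lez_nat.
apply: subset_leq_card; apply/fintype.subsetP => d; rewrite !inE => /andP[pd /asboolP bad].
apply: contraPT bad => dB; have [e e0 he] := good p d Ap pd dB.
move=> bad; near (0 : R)^'+ => h.
have : ~ A (walk p d h) by near: h.
apply; apply: he; apply/andP; split; near: h.
  exact: nbhs_right_gt.
exact: nbhs_right_lt.
Unshelve. all: by end_near.
Qed.

Lemma edge_pt_cases (P : point G -> Prop) (e : edge G) s : P (inl (src e)) ->
  P (inl (tgt e)) -> (forall h, P (inr (exist _ (e, s) h))) -> P (edge_pt e s).
Proof.
move=> Ps Pt Pi; have [s0|s0] := leP s 0; first by rewrite edge_pt_src.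
have [sL|sL] := leP (len e) s; first by rewrite edge_pt_tgt.
by rewrite edge_pt_in ?s0.
Qed.

Lemma dir_edge_pt p (d : edge G * bool) : is_dir p d -> exists t : R,
  [/\ 0 <= t <= len d.1, p = edge_pt d.1 t,
      if d.2 then 0 < t else t < len d.1 &
      forall h, walk p d h = edge_pt d.1 (if d.2 then t - h else t + h)].
Proof.
case: p => [v|[[e t] ht]] /=; case: d => [e' b] /=; have L0 := len_gt0 e'.
  case: b => /eqP <-; [exists (len e')|exists 0].
    by rewrite edge_pt_tgt // lexx ltW.
  by rewrite edge_pt_src // lexx ltW.
move=> /eqP ee; subst e'; have /andP[t0 tL] := ht; exists t; split; rewrite ?ltW //.
  by rewrite (edge_pt_in ht).
by case: b.
Qed.

End Firing.

Section Reduced.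
Variables (R : realType) (g : nat) (L : chain_lengths R g).
Local Notation C := (chain_of_loops L).
Local Open Scope classical_set_scope.
Variable D : divisor C.
Hypothesis redD : reduced_at (w_ L ord0) D.

(** Fire the point and everything to its right. The only way out is one direction at the point
    itself, so it carries less than one chip. The range of [t] includes the right end, so [v_{k+1}]
    carries no chip either. *)
Lemma reduced_bridge k (t : R) : 0 < t <= bridge_len L k ->
  coeff (edge_pt (bridge L k) t) D = 0.
Proof.
move=> ht; have [Dge0 _] := redD; have L0 := len_gt0 (bridge L k).
have LE : len (bridge L k) = bridge_len L k by [].
pose A : set (point C) := fun p => (2 * k + 1 < zone p)%N \/
  if p is inr x then ((val x).1 == bridge L k) && (t <= (val x).2) else False.
have tq : edge_pt (bridge L k) t <> w_ L ord0.
  case: (ltP t (bridge_len L k)) => tL.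
    by rewrite edge_pt_in // LE (andP ht).1.
  by rewrite edge_pt_tgt.
have Ak s : A (edge_pt (bridge L k) s) <-> t <= s.
  case: (ltP 0 s) => s0; last first.
    by rewrite edge_pt_src //; split=> [[|//]|]; [rewrite /=; lia|lra].
  case: (ltP s (len (bridge L k))) => sL; last first.
    rewrite edge_pt_tgt //; split=> _; first by lra.
    by left => /=; lia.
  rewrite edge_pt_in ?s0 // => sL'; rewrite /A /= eqxx /=; split; last by right.
  by case=> //; lia.
have Ae e : e != bridge L k ->
    (forall s, A (edge_pt e s)) \/ (forall s, ~ A (edge_pt e s)).
  case: e => [[j|j]|j] ek.
  - case: (leqP k j) => kj; [left|right] => s.
      by apply: (edge_pt_cases (P := A)) => [||h]; left; rewrite /= /bump; lia.
    apply: (edge_pt_cases (P := fun p => ~ A p)) => [||h];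
      by case=> //; rewrite /= /bump; lia.
  - case: (leqP k j) => kj; [left|right] => s.
      by apply: (edge_pt_cases (P := A)) => [||h]; left; rewrite /= /bump; lia.
    apply: (edge_pt_cases (P := fun p => ~ A p)) => [||h];
      by case=> //; rewrite /= /bump; lia.
  - have jk : (j : nat) <> k.
      by move=> jk; move: ek; rewrite eq_bridge -val_eqE /= jk eqxx.
    case: (ltnP k j) => kj; [left|right] => s.
      by apply: (edge_pt_cases (P := A)) => [||h]; left; rewrite /=; lia.
    apply: (edge_pt_cases (P := fun p => ~ A p)) => [||h];
      by rewrite /A /= ?(negbTE ek); case=> //; lia.
have Aq : ~ A (w_ L ord0) by case=> //=; lia.
have [] := @reduced_fire _ _ _ D A
    (fun p => if p == edge_pt (bridge L k) t then [set (bridge L k, true)]%SET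
              else finset.set0) redD.
- move=> e; have [->|/Ae[h|h]] := eqVneq e (bridge L k).
  + rewrite (_ : _ @^-1` _ = [set s | t <= s]); first exact: closed_ge.
    by apply/seteqP; split=> s /Ak.
  + rewrite (_ : _ @^-1` _ = setT); first exact: closedT.
    by apply/seteqP; split=> // s _; apply: h.
  + rewrite (_ : _ @^-1` _ = set0); first exact: closed0.
    by apply/seteqP; split=> // s /h.
- by exists (edge_pt (bridge L k) t); apply/Ak.
- exact: Aq.
- move=> p [e b] Ap /dir_edge_pt[s /= [hs ps sb hw]] dB.
  have [ee|ee] := eqVneq e (bridge L k); last first.
    have [h|h] := Ae _ ee; last by move: Ap; rewrite ps => /h.
    by exists 1 => // x _; rewrite hw.
  subst e; move: Ap; rewrite {1}ps => /Ak ts; case: b sb hw dB => /= sb hw dB.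
    have st : s != t.
      by apply: contraNneq dB => st; rewrite ps st eqxx finset.inE.
    exists (s - t); first by rewrite subr_gt0 lt_neqAle eq_sym st.
    by move=> h hh; rewrite hw; apply/Ak; lra.
  by exists 1 => // h hh; rewrite hw; apply/Ak; lra.
move=> p Ap; have pge0 : 0 <= coeff p D.
  by apply: Dge0; apply/eqP => pw; apply: Aq; rewrite -pw.
case: eqP pge0 => [->|_] pge0; last by rewrite finset.cards0 ltNge pge0.
rewrite finset.cards1 => lt1; apply/eqP; rewrite eq_le pge0 andbT.
by rewrite -ltzD1 add0r.
Qed.

End Reduced.

(** * Chips of a reduced divisor on a loop *)

Section ReducedLoop.
Variables (R : realType) (g : nat) (L : chain_lengths R g).
Local Notation C := (chain_of_loops L).
Local Open Scope classical_set_scope.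

(** A left inverse of [loop_pt L k] on [[0, loop_len L k)]; its values off the loop are
    irrelevant. *)
Definition loop_coord (k : 'I_g) (p : point C) : R :=
  match p with
  | inl (inl _) => bot_len L k
  | inl (inr _) => 0
  | inr x => if (val x).1 is inl (inl _) then loop_len L k - (val x).2 else (val x).2
  end.

Lemma loop_ptK k (x : R) : 0 <= x < loop_len L k -> loop_coord k (loop_pt L k x) = x.
Proof.
rewrite /loop_len => /andP[x0 xL]; rewrite /loop_pt; case: leP => xm.
  have [x0'|x0'] := leP x 0; first by rewrite edge_pt_src //=; lra.
  have [mx|mx] := leP (bot_len L k) x; first by rewrite edge_pt_tgt //=; lra.
  by rewrite edge_pt_in ?x0'.
rewrite /loop_len edge_pt_in => [|h] /=; last by rewrite /loop_len; lra.
by apply/andP; split=> /=; lra.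
Qed.

Lemma loop_pt_inj k (x y : R) : 0 <= x < loop_len L k -> 0 <= y < loop_len L k ->
  loop_pt L k x = loop_pt L k y -> x = y.
Proof. by move=> hx hy e; rewrite -(loop_ptK hx) -(loop_ptK hy) e. Qed.

Lemma loop_len_gt (k : 'I_g) : [/\ 0 < bot_len L k, 0 < top_len L k &
  loop_len L k = top_len L k + bot_len L k].
Proof. by split=> //; [exact: bot_len_gt0|exact: top_len_gt0]. Qed.

Lemma loop_pt0 k : loop_pt L k 0 = v_succ L (widen_ord (leqnSn g) k).
Proof. by rewrite /loop_pt ltW ?bot_len_gt0 // edge_pt_src. Qed.

Lemma loop_pt_bot k : loop_pt L k (bot_len L k) = w_ L (lift ord0 k).
Proof. by rewrite /loop_pt lexx edge_pt_tgt. Qed.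

Lemma loop_ptP (k : 'I_g) p : zone p = (2 * k + 2)%N ->
  exists2 x : R, 0 <= x < loop_len L k & p = loop_pt L k x.
Proof.
have [m0 l0 LE] := loop_len_gt k.
case: p => [[j|j]|[[[[j|j]|j] t] h]] /= jk.
- exists (bot_len L k); first by rewrite LE; lra.
  by rewrite loop_pt_bot; congr (inl (inl _)); apply: val_inj; rewrite /= /bump; lia.
- exists 0; first by rewrite LE; lra.
  by rewrite loop_pt0; congr (inl (inr _)); apply: val_inj => /=; lia.
- have jk' : j = k by apply: val_inj => /=; lia.
  subst j; have /= /andP[t0 tl] := h.
  exists (loop_len L k - t); first by rewrite LE; lra.
  rewrite /loop_pt LE leNgt (_ : _ < _ = true) /=; last by lra.
  by rewrite /loop_len opprB addrC subrK (edge_pt_in (e := top L k) h).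
- have jk' : j = k by apply: val_inj => /=; lia.
  subst j; have /= /andP[t0 tl] := h.
  exists t; first by rewrite LE; lra.
  by rewrite /loop_pt (ltW tl) (edge_pt_in (e := bot L k) h).
- by lia.
Qed.

(** Fire the arc from [a] to [b]. It can be left only at its two ends, in one direction each, so
    some point has fewer chips than there are ends of the arc at it. For [a = b] both ends coincide
    and the bound at that point is 2. *)
Lemma reduced_arc (D : divisor C) k (a b : R) : reduced_at (w_ L ord0) D ->
  0 < a <= b -> b < loop_len L k ->
  exists2 p, 0 <= coeff p D &
    coeff p D < (p == loop_pt L k a)%:Z + (p == loop_pt L k b)%:Z.
Proof.
move=> redD ha bL; have [Dge0 _] := redD.
have [m0 l0 LE] := loop_len_gt k; set m := bot_len L k in m0 LE *.
set l := top_len L k in l0 LE *; set LL := loop_len L k in bL LE *.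
have lt : len (top L k) = l by []; have lb : len (bot L k) = m by [].
have lE x : loop_pt L k x = if x <= m then edge_pt (bot L k) x else edge_pt (top L k) (LL - x).
  by [].
pose far := (a <= m) && (m <= b).
(* The arc from a to b, with everything to the right of w if the arc contains w. *)
pose A : set (point C) := fun p => match p with
  | inl (inl j) => (k < j)%N && far
  | inl (inr j) => (k < j)%N && far
  | inr x => match (val x).1 with
    | inl (inl j) => if j == k then a <= LL - (val x).2 <= b else (k < j)%N && far
    | inl (inr j) => if j == k then a <= (val x).2 <= b else (k < j)%N && far
    | inr j => (k < j)%N && far
    end
  end.
have Ab s : A (edge_pt (bot L k) s) <-> a <= Num.min s m <= b.
  have [s0|s0] := leP s 0.
    rewrite edge_pt_src // min_l /=; last by lra.
    by rewrite ltnn /=; split => // ?; exfalso; lra.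
  have [sm|sm] := leP m s.
    by rewrite edge_pt_tgt //= /bump /= add1n ltnS leqnn.
  by rewrite edge_pt_in ?s0 //= eqxx.
have At s : A (edge_pt (top L k) s) <-> a <= LL - Num.min s l <= b.
  have [s0|s0] := leP s 0.
    rewrite edge_pt_src // min_l /=; last by lra.
    by rewrite ltnn /=; split => // ?; exfalso; lra.
  have [sm|sm] := leP l s.
    rewrite edge_pt_tgt //= /bump /= add1n ltnS leqnn /=.
    by rewrite (_ : LL - l = m) // LE; ring.
  by rewrite edge_pt_in ?s0 //= eqxx.
have Ae e : e != top L k -> e != bot L k ->
    (forall s, A (edge_pt e s)) \/ (forall s, ~ A (edge_pt e s)).
  move=> et eb; have [nf|nf] := boolP far; last first.
    right=> s; apply: (edge_pt_cases (P := fun p => ~ A p)).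
    - by case: e et eb => [[j|j]|j] et eb; rewrite /A /= (negbTE nf) andbF.
    - by case: e et eb => [[j|j]|j] et eb; rewrite /A /= (negbTE nf) andbF.
    - by case: e et eb => [[j|j]|j]; rewrite ?eq_top ?eq_bot => et eb h;
        rewrite /A /= ?(negbTE et) ?(negbTE eb) (negbTE nf) andbF.
  case: e et eb => [[j|j]|j]; rewrite ?eq_top ?eq_bot => et eb; case: (ltnP k j) => kj.
  - left=> s; apply: (edge_pt_cases (P := A)) => [||h];
      by rewrite /A /= ?(negbTE et) nf ?andbT // /bump /= add1n ltnS ltnW.
  - right=> s; apply: (edge_pt_cases (P := fun p => ~ A p)) => [||h];
      rewrite /A /= ?(negbTE et) nf ?andbT.
    + by rewrite ltnNge kj.
    + by rewrite /bump /= add1n ltnS leq_eqVlt val_eqE eq_sym (negbTE et) ltnNge kj.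
    + by rewrite ltnNge kj.
  - left=> s; apply: (edge_pt_cases (P := A)) => [||h];
      by rewrite /A /= ?(negbTE eb) nf ?andbT // /bump /= add1n ltnS ltnW.
  - right=> s; apply: (edge_pt_cases (P := fun p => ~ A p)) => [||h];
      rewrite /A /= ?(negbTE eb) nf ?andbT.
    + by rewrite ltnNge kj.
    + by rewrite /bump /= add1n ltnS leq_eqVlt val_eqE eq_sym (negbTE eb) ltnNge kj.
    + by rewrite ltnNge kj.
  - by left=> s; apply: (edge_pt_cases (P := A)) => [||h]; rewrite /A /= nf ?andbT.
  - right=> s; apply: (edge_pt_cases (P := fun p => ~ A p)) => [||h];
      by rewrite /A /= nf ?andbT ltnNge kj.
have Aq : ~ A (w_ L ord0) by rewrite /A /=.
(* If an end of the arc is the right vertex of the loop, the arc is left along the bottom edge at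
   [a] and along the top edge at [b]; hence [<=] here and [<] in [db]. *)
pose da : edge C * bool := if a <= m then (bot L k, true) else (top L k, false).
pose db : edge C * bool := if b < m then (bot L k, false) else (top L k, true).
pose B p : {set edge C * bool} :=
  ([set d | (p == loop_pt L k a) && (d == da)] :|: [set d | (p == loop_pt L k b) && (d == db)])%SET.
have cardB p : (#|B p| <= (p == loop_pt L k a) + (p == loop_pt L k b))%N.
  rewrite (leq_trans (leq_card_setU _ _)) //; apply: leq_add.
    case: eqP => _; last by rewrite eq_card0 // => d; rewrite !inE.
    by rewrite (eq_card (B := pred1 da)) ?card1 // => d; rewrite !inE.
  case: eqP => _; last by rewrite eq_card0 // => d; rewrite !inE.
  by rewrite (eq_card (B := pred1 db)) ?card1 // => d; rewrite !inE.
have min_cont (c : R) : continuous (fun s : R => Num.min s c).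
  by move=> s; apply: continuous_min; [exact: cvg_id|exact: cst_continuous].
have [] := @reduced_fire _ _ _ D A B redD.
- move=> e; have [->|eb] := eqVneq e (bot L k).
    rewrite (_ : _ @^-1` _ = (fun s => Num.min s m) @^-1` `[a, b]%classic).
      by apply: closed_comp; [move=> s _; exact: min_cont|exact: itv_closed].
    by apply/seteqP; split=> s; rewrite /= in_itv /= => /Ab.
  have [->|et] := eqVneq e (top L k).
    rewrite (_ : _ @^-1` _ = (fun s => LL - Num.min s l) @^-1` `[a, b]%classic).
      apply: closed_comp; last exact: itv_closed.
      by move=> s _; apply: cvgB; [exact: cvg_cst|exact: min_cont].
    by apply/seteqP; split=> s; rewrite /= in_itv /= => /At.
  have [h|h] := Ae e et eb.
    rewrite (_ : _ @^-1` _ = setT); first exact: closedT.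
    by apply/seteqP; split=> // s _; apply: h.
  rewrite (_ : _ @^-1` _ = set0); first exact: closed0.
  by apply/seteqP; split=> // s /h.
- exists (loop_pt L k a); rewrite lE; case: leP => am.
    by apply/Ab; rewrite min_l //; lra.
  by apply/At; rewrite min_l //; lra.
- exact: Aq.
- move=> p [e c] Ap /dir_edge_pt[s /= [hs ps sb hw]] dB.
  have [ee|eb] := eqVneq e (bot L k).
    subst e; move: Ap; rewrite {1}ps => /Ab; rewrite -[chain_len L _]/m in hs sb.
    rewrite min_l; last by lra.
    move=> sab; case: c sb hw dB => /= sb hw dB.
      have sa : s != a.
        apply: contraNneq dB => sa; have am : a <= m by lra.
        by rewrite finset.inE finset.inE ps sa lE /da am !eqxx.
      exists (s - a); first by rewrite subr_gt0 lt_neqAle eq_sym sa; lra.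
      by move=> h hh; rewrite hw; apply/Ab; rewrite min_l; lra.
    have sb' : s != b.
      apply: contraNneq dB => sb'; have bm : b < m by lra.
      by rewrite finset.inE orbC finset.inE ps sb' lE /db bm (ltW bm) !eqxx.
    exists (Num.min (b - s) (m - s)).
      by rewrite lt_min !subr_gt0 [s < b]lt_neqAle sb'; lra.
    by move=> h; rewrite lt_min => hh; rewrite hw; apply/Ab; rewrite min_l; lra.
  have [ee|et] := eqVneq e (top L k).
    subst e; move: Ap; rewrite {1}ps => /At; rewrite -[chain_len L _]/l in hs sb.
    rewrite min_l; last by lra.
    move=> sab; case: c sb hw dB => /= sb hw dB.
      have sb' : LL - s != b.
        apply: contraNneq dB => sb'; have bm : m <= b by lra.
        rewrite finset.inE orbC finset.inE ps lE /db ltNge bm /= eqxx andbT.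
        have [bm'|bm'] := leP b m; last by rewrite (_ : LL - b = s) ?eqxx //; lra.
        rewrite (edge_pt_tgt (e := top L k)); last by rewrite lt; lra.
        by rewrite (edge_pt_tgt (e := bot L k)) ?lb // eqxx.
      exists (Num.min s (b - (LL - s))).
        by rewrite lt_min sb subr_gt0 lt_neqAle sb'; lra.
      by move=> h; rewrite lt_min => hh; rewrite hw; apply/At; rewrite min_l; lra.
    have sa : LL - s != a.
      apply: contraNneq dB => sa; have am : m < a by lra.
      rewrite finset.inE finset.inE ps lE /da leNgt am /= eqxx andbT.
      by rewrite (_ : LL - a = s) ?eqxx //; lra.
    exists (Num.min (l - s) (LL - s - a)).
      by rewrite lt_min !subr_gt0 [a < _]lt_neqAle eq_sym sa; lra.
    by move=> h; rewrite lt_min => hh; rewrite hw; apply/At; rewrite min_l; lra.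
  have [h|h] := Ae _ et eb; last by move: Ap; rewrite ps => /h.
  by exists 1 => // x _; rewrite hw.
move=> p Ap lt_p; exists p.
  by apply: Dge0; apply/eqP => pw; apply: Aq; rewrite -pw.
by apply: lt_le_trans lt_p _; rewrite -PoszD lez_nat.
Qed.

Section Chips.
Variable D : divisor C.
Hypothesis redD : reduced_at (w_ L ord0) D.

(** The left vertex carries no chip, being the right end of a bridge. Chips at two other points
    would contradict [reduced_arc] for the arc between them, and two chips at one point for the arc
    with [a = b]. So the position 0 safely encodes a loop without chip. *)
Lemma chip_posP (k : 'I_g) : [/\ 0 <= chip_pos D k < loop_len L k &
  forall p, zone p = (2 * k + 2)%N ->
    coeff p D = ((chip_pos D k != 0) && (p == loop_pt L k (chip_pos D k)))%:Z].
Proof.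
have [m0 l0 LE] := loop_len_gt k; have [Dge0 _] := redD.
have v0 : coeff (loop_pt L k 0) D = 0.
  pose k0 := widen_ord (leqnSn g) k.
  rewrite loop_pt0 -(reduced_bridge redD (k := k0) (t := bridge_len L k0)) ?lexx ?bridge_len_gt0 //.
  by rewrite edge_pt_tgt.
have wz p : zone p = (2 * k + 2)%N -> p != w_ L ord0.
  by move=> zp; apply/eqP => pw; move: zp; rewrite pw /=; lia.
have uniq_chip p (x : R) : 0 <= x < loop_len L k -> 0 < coeff (loop_pt L k x) D ->
    zone p = (2 * k + 2)%N -> coeff p D = (p == loop_pt L k x)%:Z.
  move=> hx cx zp; have [y hy py] := loop_ptP zp.
  have x0 : 0 < x.
    rewrite lt_neqAle eq_sym (andP hx).1 andbT; apply: contraTneq cx => ->.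
    by rewrite v0 ltxx.
  have [y0|y0] := eqVneq y 0.
    rewrite py y0 v0; case: eqP => // e; move: cx; rewrite -e v0 ltxx //.
  have {}y0 : 0 < y by rewrite lt_neqAle eq_sym y0 (andP hy).1.
  have arc a b : 0 < a < b -> b < loop_len L k -> 0 < coeff (loop_pt L k a) D ->
      0 < coeff (loop_pt L k b) D -> False.
    move=> hab bL ca cb.
    have [|q q0] := @reduced_arc D k a b redD _ bL; first by lra.
    case: eqP => [->|_]; last by case: eqP q0 => [->|_] q0; move: q0 ca cb; clear; lia.
    case: eqP => [/loop_pt_inj e _|_]; last by move: ca; clear; lia.
    by have := e _ _; lra.
  case: (ltgtP x y) => xy.
  - have -> : (p == loop_pt L k x) = false.
      by rewrite py; apply/eqP => /loop_pt_inj e; have := e hy hx; lra.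
    apply/eqP; rewrite eq_le Dge0 ?wz // andbT leNgt; apply/negP => cp.
    by apply: (arc x y) => //; [lra|lra|rewrite -py].
  - have -> : (p == loop_pt L k x) = false.
      by rewrite py; apply/eqP => /loop_pt_inj e; have := e hy hx; lra.
    apply/eqP; rewrite eq_le Dge0 ?wz // andbT leNgt; apply/negP => cp.
    by apply: (arc y x) => //; [lra|lra|rewrite -py].
  rewrite py -xy eqxx /=; have [||q q0] := @reduced_arc D k x x redD; [by lra|by lra|].
  by case: eqP => [->|_] ?; lia.
rewrite /chip_pos; case: xgetP => [x _ [hx cx]|nochip].
  have x0 : x != 0 by apply: contraTneq cx => ->; rewrite v0 ltxx.
  by split=> // p zp; rewrite x0; exact: uniq_chip.
split=> [|p zp]; first by rewrite LE; lra.
have [y hy py] := loop_ptP zp; rewrite eqxx /=; apply/eqP.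
rewrite eq_le Dge0 ?wz // andbT leNgt; apply/negP => cp.
by apply: (nochip y); split; rewrite -?py.
Qed.

End Chips.
End ReducedLoop.

(** * Change of functions along bridges and across loops *)

Section FlowConsequences.
Variables (R : realType) (g : nat) (L : chain_lengths R g).
Local Notation C := (chain_of_loops L).
Implicit Types (psi : plfun C) (D E F : divisor C).

Lemma effectiveP E : effective E -> forall p, 0 <= coeff p E.
Proof. exact/fgposP. Qed.

Lemma ldegB n E F : ldeg n (E - F) = ldeg n E - ldeg n F.
Proof. exact: wdegB. Qed.

Lemma zdeg_ge0 n E : effective E -> 0 <= zdeg n E.
Proof. by move=> /effectiveP E0; apply: wdeg_ge0 => // p; case: (_ == _). Qed.

Lemma ldeg_ge0 n E : effective E -> 0 <= ldeg n E.
Proof. by move=> /effectiveP E0; apply: wdeg_ge0 => // p; case: (_ <= _)%N. Qed.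

Lemma ldeg_le_deg n E : effective E -> ldeg n E <= deg E.
Proof.
move=> /effectiveP E0; rewrite deg_wdeg; apply: ler_wdeg => // p.
by case: (_ <= _)%N.
Qed.

Lemma coeff_zdeg0 n E p : effective E -> zdeg n E = 0 -> zone p = n -> coeff p E = 0.
Proof.
move=> /effectiveP E0 z0 zp; apply/eqP; rewrite eq_le E0 andbT -z0 -wdeg_at_point.
apply: ler_wdeg => // q; rewrite /at_point; case: (eqVneq q p) => [->|_].
  by rewrite zp eqxx.
by case: (_ == _).
Qed.

Lemma bridge_linear psi E (k : 'I_g.+1) :
  is_div psi E -> (forall p, zone p = (2 * k + 1)%N -> coeff p E = 0) ->
  forall t, 0 <= t <= bridge_len L k ->
  psi (edge_pt (bridge L k) t) = psi (w_ L k) - (ldeg (2 * k) E)%:~R * t.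
Proof.
move=> psiE E0 t ht; have [c [cedge cb _ _]] := chain_flow psiE.
rewrite (cedge (bridge L k)) // cb rmorphN mulNr wdeg_eq0 ?subr0 // => -[v|x] /=.
  by rewrite mul0rz.
case: eqP => [xk|_]; last by rewrite mul0rz.
rewrite [coeff _ E]E0 ?mulr0z //=.
by move: xk; case: x => -[[[j|j]|j] s] /= h // [->].
Qed.

Section LoopRule.
Variable D : divisor C.
Hypothesis redD : reduced_at (w_ L ord0) D.

Lemma wdeg_chip (V : zmodType) (w : point C -> V) (k : 'I_g) :
  (forall p, zone p != (2 * k + 2)%N -> w p = 0) ->
  wdeg w D = if chip_pos D k == 0 then 0 else w (loop_pt L k (chip_pos D k)).
Proof.
move=> w0; have [hx hc] := chip_posP redD k; set x := chip_pos D k in hx hc *.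
rewrite (@wdeg1 _ _ _ _ (loop_pt L k x)); last first.
  move=> q qx; case: (eqVneq (zone q) (2 * k + 2)%N) => [zq|/w0->]; last by rewrite mul0rz.
  by rewrite hc // (negbTE qx) andbF mulr0z.
case: (eqVneq (zone (loop_pt L k x)) (2 * k + 2)%N) => [zx|/w0->]; last first.
  by rewrite mul0rz if_same.
by rewrite hc // eqxx andbT; case: eqP.
Qed.

Lemma zone_loop_pt (k : 'I_g) (x : R) : zone (loop_pt L k x) = (2 * k + 2)%N.
Proof.
by rewrite /loop_pt; case: leP => _;
  apply: (edge_pt_cases (P := fun p => zone p = (2 * k + 2)%N)) => //=;
  rewrite /bump /= add1n mulnS addnC.
Qed.

Lemma zdeg_chip (k : 'I_g) : zdeg (2 * k + 2) D = (chip_pos D k != 0)%:Z.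
Proof.
rewrite /zdeg (@wdeg_chip _ _ k) => [|p /negbTE-> //].
by rewrite zone_loop_pt eqxx; case: eqP.
Qed.

Lemma edge_kink_bot_loop (k : 'I_g) (x : R) : 0 <= x < loop_len L k -> x != 0 ->
  edge_kink (bot L k) (bot_len L k) (loop_pt L k x) = Num.max (bot_len L k - x) 0.
Proof.
have [m0 l0 LE] := loop_len_gt L k; rewrite LE => hx x0.
have {}x0 : 0 < x by rewrite lt_neqAle eq_sym x0 (andP hx).1.
rewrite /loop_pt; case: (ltgtP x (bot_len L k)) => xm.
- by rewrite edge_pt_in ?x0 //= eqxx.
- rewrite edge_pt_in => [|h] /=; last by rewrite max_r //; lra.
  by rewrite LE; lra.
- by rewrite xm edge_pt_tgt //= subrr maxxx.
Qed.

Lemma edge_kink_top_loop (k : 'I_g) (x : R) : 0 <= x < loop_len L k -> x != 0 ->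
  edge_kink (top L k) (top_len L k) (loop_pt L k x) = Num.max (x - bot_len L k) 0.
Proof.
have [m0 l0 LE] := loop_len_gt L k; rewrite LE => hx x0.
have {}x0 : 0 < x by rewrite lt_neqAle eq_sym x0 (andP hx).1.
rewrite /loop_pt; case: (ltgtP x (bot_len L k)) => xm.
- by rewrite edge_pt_in ?x0 //= max_r //; lra.
- rewrite edge_pt_in => [|h] /=; last by rewrite eqxx; congr (Num.max _ _); rewrite LE; lra.
  by rewrite LE; lra.
- by rewrite xm edge_pt_tgt //= subrr maxxx.
Qed.

Lemma edge_kink_zone (k : 'I_g) (t : R) p : zone p != (2 * k + 2)%N ->
  edge_kink (bot L k) t p = 0 /\ edge_kink (top L k) t p = 0.
Proof.
case: p => [//|[[e s] h]] /=; rewrite eq_bot eq_top.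
case: e h => [[j|j]|j] h //= zp; split=> //; case: eqP => // jk;
  by move: zp; rewrite jk eqxx.
Qed.

Lemma loop_values psi E (k : 'I_g) : is_div psi E ->
  exists cb ct : int, [/\ cb + ct =
      - ldeg (2 * k + 1) E - coeff (v_succ L (widen_ord (leqnSn g) k)) E,
    psi (w_ L (lift ord0 k)) = psi (v_succ L (widen_ord (leqnSn g) k)) +
      cb%:~R * bot_len L k - wdeg (edge_kink (bot L k) (bot_len L k)) E &
    psi (w_ L (lift ord0 k)) = psi (v_succ L (widen_ord (leqnSn g) k)) +
      ct%:~R * top_len L k - wdeg (edge_kink (top L k) (top_len L k)) E].
Proof.
move=> psiE; have [c [cedge _ cv _]] := chain_flow psiE.
exists (c (bot L k)), (c (top L k)); split=> //.
  have := cedge (bot L k) (bot_len L k); rewrite edge_pt_tgt //; apply.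
  by rewrite lexx ltW ?bot_len_gt0.
have := cedge (top L k) (top_len L k); rewrite edge_pt_tgt //; apply.
by rewrite lexx ltW ?top_len_gt0.
Qed.

(** Compute [psi] at the right vertex along both edges, with initial slopes [cb] and [ct]. A chip of
    [D] at [x] on either edge turns the equality of the two results into [(cb + ct + 1) * bot_len -
    x = ct * loop_len]; without a chip, [1] and [x] are absent. *)
Lemma loop_rule psi E (k : 'I_g) : effective E -> is_div psi (E - D) ->
  zdeg (2 * k + 2) E = 0 ->
  eqmod_loop L k (chip_pos D k)
    ((ldeg (2 * k + 1) D - ldeg (2 * k + 1) E + (chip_pos D k != 0)%:Z)%:~R * bot_len L k).
Proof.
move=> E0 psiE zE; have [m0 l0 LE] := loop_len_gt L k.
have [cb [ct [cs hb ht]]] := loop_values k psiE.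
have [hx hc] := chip_posP redD k; set x := chip_pos D k in hx hc *.
have Ez (w : point C -> R) : (forall p, zone p != (2 * k + 2)%N -> w p = 0) -> wdeg w E = 0.
  move=> w0; apply: wdeg_eq0 => q; case: (eqVneq (zone q) (2 * k + 2)%N) => [zq|/w0->].
    by rewrite (coeff_zdeg0 E0 zE zq) mulr0z.
  by rewrite mul0rz.
have vz : zone (v_succ L (widen_ord (leqnSn g) k)) = (2 * k + 2)%N by [].
have v0 : coeff (v_succ L (widen_ord (leqnSn g) k)) (E - D) = 0.
  rewrite coeffB (coeff_zdeg0 E0 zE vz) hc // -loop_pt0; case: (eqVneq x 0) => [->|x0] /=.
    by rewrite subr0.
  case: eqP => [/loop_pt_inj e|_]; last by rewrite subr0.
  by move: x0; rewrite -e ?eqxx ?hx //; lra.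
have kb p : zone p != (2 * k + 2)%N -> edge_kink (bot L k) (bot_len L k) p = 0.
  by case/(edge_kink_zone (bot_len L k)).
have kt p : zone p != (2 * k + 2)%N -> edge_kink (top L k) (top_len L k) p = 0.
  by case/(edge_kink_zone (top_len L k)).
move: hb ht cs; rewrite v0 !wdegB Ez // Ez // (wdeg_chip kb) (wdeg_chip kt) -/x subr0.
rewrite ldegB => hb ht cs; rewrite /eqmod_loop.
suff -> : (x - (ldeg (2 * k + 1) D - ldeg (2 * k + 1) E + (x != 0)%:Z)%:~R * bot_len L k)
    / loop_len L k = (- ct)%:~R by exact: intr_int.
have -> : ldeg (2 * k + 1) D - ldeg (2 * k + 1) E = cb + ct by lia.
apply: (canLR (mulfK _)); first by rewrite gt_eqF // LE; lra.
rewrite !rmorphD rmorphN /= LE.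
case: (eqVneq x 0) hb ht => [->|x0] hb ht /=; first by lra.
move: hb ht; rewrite edge_kink_bot_loop // edge_kink_top_loop //.
case: (leP x (bot_len L k)) => xm.
  by rewrite max_l ?max_r; [lra|lra|lra].
by rewrite max_r ?max_l; [lra|lra|lra].
Qed.

End LoopRule.

(** Along each edge the difference [psi - psi'] rises by at most an integer times the length, and
    the two integers add up to at most [deg E']. Either the one for the top edge is at most 0, or
    the one for the bottom edge is at most [deg E' - 1]. *)
Lemma loop_variation psi psi' E E' F (k : 'I_g) : effective E -> effective E' ->
  is_div psi (E - F) -> is_div psi' (E' - F) ->
  let h := (psi (w_ L (lift ord0 k)) - psi' (w_ L (lift ord0 k))) -
    (psi (v_succ L (widen_ord (leqnSn g) k)) - psi' (v_succ L (widen_ord (leqnSn g) k))) in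
  h <= 0 \/ h <= (deg E' - 1)%:~R * bot_len L k.
Proof.
move=> E0 E0' psiE psiE' h; have [m0 l0 LE] := loop_len_gt L k.
have [cb [ct [cs hb ht]]] := loop_values k psiE.
have [cb' [ct' [cs' hb' ht']]] := loop_values k psiE'.
have kge0 e t p : 0 <= edge_kink (e : edge C) t p :> R.
  by case: p => [//|x] /=; case: ifP => // _; rewrite le_max lexx orbT.
have kE e t : 0 <= wdeg (edge_kink (e : edge C) t) E.
  by apply: wdeg_ge0 => //; exact: effectiveP.
have kE' e : wdeg (edge_kink (e : edge C) (len e)) E' <= (wdeg (on_edge e) E')%:~R * len e.
  rewrite /wdeg rmorph_sum mulr_suml; apply: ler_sum => p _ /=.
  rewrite mulrzz rmorphM /= mulrAC -[X in X <= _]mulrzr; apply: ler_wpM2r.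
    by rewrite ler0z; exact: effectiveP.
  case: p => [v|[[j s] /= hs]] /=; first by rewrite mul0r.
  case: eqP => [je|_]; last by rewrite mul0r.
  by rewrite mul1r ge_max; case/andP: hs => s0 _; have /= := len_gt0 e; lra.
have nb := kE' (bot L k); have nt := kE' (top L k).
move: hb ht cs hb' ht' cs'; rewrite !ldegB !coeffB !wdegB.
set p := v_succ L _; set q := w_ L _.
move: (kE (bot L k) (bot_len L k)) (kE (top L k) (top_len L k)).
move: nb nt; rewrite -[len (bot L k)]/(bot_len L k) -[len (top L k)]/(top_len L k).
set Nb := wdeg (on_edge (bot L k)) E'; set Nt := wdeg (on_edge (top L k)) E'.
move=> nb nt e1 e2 hb ht cs hb' ht' cs'.
(* The kinks [f] of the common divisor [F] cancel, those of [E] only lower the difference, and those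
   of [E'] raise it by at most [n * l]. *)
have rise (x x' y y' l e e' f : R) (c c' n : int) :
    x = y + c%:~R * l - (e - f) -> x' = y' + c'%:~R * l - (e' - f) -> 0 <= e ->
    e' <= n%:~R * l -> (x - x') - (y - y') <= (c - c' + n)%:~R * l.
  by clear=> -> -> e0 en; rewrite rmorphD rmorphB /=; lra.
have hbot := rise _ _ _ _ _ _ _ _ _ _ _ hb hb' e1 nb.
have htop := rise _ _ _ _ _ _ _ _ _ _ _ ht ht' e2 nt.
have zE' := zdeg_loop k E'; rewrite -/p -/q -/Nb -/Nt in zE'.
have ldE : ldeg (2 * k + 1) E' + zdeg (2 * k + 2) E' <= deg E'.
  by rewrite -ldeg_loop; exact: ldeg_le_deg.
have := ldeg_ge0 (2 * k + 1) E0; have := effectiveP E0 p => pE lE.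
have := effectiveP E0' q => qE'.
case: (leP (ct - ct' + Nt) 0) => ctN.
  left; apply: le_trans htop _; apply: mulr_le0_ge0; [by rewrite lerz0|exact: ltW].
right; apply: le_trans hbot _; rewrite ler_pM2r // ler_int; lia.
Qed.

End FlowConsequences.

(** * The lingering lattice path *)

Section LatticePath.
Variables (R : realType) (g : nat) (L : chain_lengths R g) (r : nat).
Variable D : divisor (chain_of_loops L).
Local Notation x_ k := (chip_pos D k).
Local Notation chip k := ((chip_pos D k != 0)%:Z).
Local Notation p_ k := (llp r D k).

Lemma in_chamberP (y : 'rV[int]_r) : reflect
  ((forall j, 0 < y 0 j) /\ forall j j' : 'I_r, (j < j')%N -> y 0 j' < y 0 j)
  (in_chamber y).
Proof.
apply: (iffP andP) => -[y0 y1]; split.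
- exact/forallP.
- by move=> j j' jj'; have /forallP/(_ j)/forallP/(_ j')/implyP/(_ jj') := y1.
- exact/forallP.
- by apply/forallP => j; apply/forallP => j'; apply/implyP; exact: y1.
Qed.

Lemma llp0 j : p_ 0 0 j = coeff (w_ L ord0) D - (j : nat)%:Z.
Proof. by rewrite /llp take0 /= mxE. Qed.

Lemma llpS (k : 'I_g) : p_ k.+1 = p_ k + llp_step D k (p_ k).
Proof.
rewrite /llp (take_nth k) ?size_enum_ord // nth_ord_enum.
by rewrite foldl_rcons.
Qed.

Hypothesis small : forall k : 'I_g, (2 * g + 3)%:R * bot_len L k < loop_len L k.

Lemma eqmod_uniq (k : 'I_g) (x : R) (a b : int) : `|a - b| <= (2 * g + 3)%:Z ->
  eqmod_loop L k x (a%:~R * bot_len L k) -> eqmod_loop L k x (b%:~R * bot_len L k) ->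
  a = b.
Proof.
have [m0 l0 LE] := loop_len_gt L k; move=> ab /intrP[u xu] /intrP[v xv].
have L0 : 0 < loop_len L k by rewrite LE; lra.
have uv : (v - u)%:~R * loop_len L k = (a - b)%:~R * bot_len L k.
  rewrite !rmorphB /= mulrBl -xu -xv !divfK ?gt_eqF //; lra.
have : `|v - u| < 1.
  rewrite -(ltr_int R) -(ltr_pM2r L0) mul1r intr_norm -{1}(gtr0_norm L0) -normrM uv.
  rewrite normrM (gtr0_norm m0); apply: le_lt_trans (small k).
  by rewrite ler_pM2r // -intr_norm [X in _ <= X]pmulrn ler_int.
rewrite -[1]add0r ltzD1 normr_le0 => vu; move: uv.
move/eqP in vu; rewrite vu mul0r => /esym/eqP; rewrite mulf_eq0 (gt_eqF m0) orbF.
by rewrite intr_eq0 subr_eq0 => /eqP.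
Qed.

(* Slopes at the left and right ends of the bridge from w_k to v_{k+1}. *)
Variables sL sR : nat -> 'I_r.+1 -> int.
(** [ld k] stands for the number of chips of [D] up to [w_k]. The hypotheses that follow isolate
    what the argument needs from geometry; [loss] and [gain] say what one loop can do to a slope. *)
Variable ld : nat -> int.
Hypothesis x_range : forall k : 'I_g, 0 <= x_ k < loop_len L k.
Hypothesis sRL : forall (k : 'I_g.+1) i, sR k i <= sL k i.
Hypothesis loss : forall (k : 'I_g) i, sL k.+1 i <= sR k i + chip k.
Hypothesis gain : forall (k : 'I_g) i, sL k.+1 i = sR k i + chip k ->
  eqmod_loop L k (x_ k) ((sR k i + chip k)%:~R * bot_len L k).
Hypothesis sL_first : forall i : 'I_r.+1, sL 0 i <= coeff (w_ L ord0) D - (i : nat)%:Z.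
Hypothesis sR_last : forall i : 'I_r.+1, (r - i)%N%:Z <= sR g i.
Hypothesis sR_ld : forall (k : 'I_g.+1) i, sR k i <= ld k.
Hypothesis ld0 : ld 0 = coeff (w_ L ord0) D.
Hypothesis ldS : forall k : 'I_g, ld k.+1 = ld k + chip k.
Hypothesis ld_deg : ld g = deg D.
Hypothesis deg_small : deg D <= (2 * g + 3)%:Z.
Hypothesis avoid : vertex_avoiding r D.

Local Notation wide := (widen_ord (leqnSn r)).

Lemma ord_induction_down (P : nat -> Prop) :
  (forall k : 'I_g, P k -> P k.+1) -> forall k, (k <= g)%N -> P k -> P g.
Proof.
move=> PS k; rewrite leq_eqVlt => /predU1P[->//|].
move: {2}(g - k)%N (leqnn (g - k)) => n; elim: n k => [|n IH] k nk kg Pk; first by lia.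
have Pk1 : P k.+1 by exact: PS (Ordinal kg) Pk.
have [<-//|kg1] := eqVneq k.+1 g.
by apply: IH Pk1; lia.
Qed.

Lemma not_eqmod0 (k : 'I_g) : x_ k != 0 -> ~~ eqmod_loop L k (x_ k) (0%:~R * bot_len L k).
Proof.
move=> x0; have /andP[xge xlt] := x_range k; apply/negP => /intrP[n].
rewrite mul0r subr0 => xn.
have [m0 l0 LE] := loop_len_gt L k; have L0 : 0 < loop_len L k by rewrite LE; lra.
have xE : x_ k = n%:~R * loop_len L k by rewrite -xn divfK ?gt_eqF.
have n0 : 0 < n.
  by rewrite -(ltr0z R) -(pmulr_lgt0 _ L0) -xE lt_neqAle eq_sym x0.
have : n < 1 by rewrite -(ltr_int R) -(ltr_pM2r L0) mul1r -xE.
by lia.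
Qed.

(* A negative slope stays negative, since rising from -1 to 0 needs a chip at 0. *)
Lemma sR_ge0 k i : (k <= g)%N -> 0 <= sR k i.
Proof.
move=> kg; rewrite leNgt; apply/negP => s0.
suff : sR g i < 0 by have := sR_last i; lia.
apply: (@ord_induction_down (fun k => sR k i < 0)) kg s0 => j sj.
have /= := sRL (lift ord0 j) i; rewrite /bump /= add1n => le1.
have := loss j i; have := @gain j i; have := @not_eqmod0 j; case: eqP => x0 /=; first by lia.
move=> /(_ isT) n0 gn ls; have [e|e] := eqVneq (sR j i) (-1); last by lia.
have : sL j.+1 i <> sR j i + 1 by move=> /gn; rewrite e (negbTE n0).
by lia.
Qed.

(** Rising from 0 to 1 needs a chip congruent to [bot_len], which vertex avoidance excludes. *)
Lemma sR_le0_stays k l i : (k <= l <= g)%N -> sR k i <= 0 -> sR l i <= 0.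
Proof.
elim: l => [|l IH] /andP[kl lg] s0; first by move: kl s0; rewrite leqn0 => /eqP->.
move: kl; rewrite leq_eqVlt => /predU1P[<-//|kl].
have {IH}s0 : sR l i <= 0 by apply: IH => //; rewrite -ltnS kl ltnW.
pose j := Ordinal lg; have [_ avm _] := avoid.
have /= := sRL (lift ord0 j) i; rewrite /bump /= add1n => le1.
have := loss j i; have := @gain j i; have := avm j; case: eqP => x0 /=; first by lia.
move=> n0 gn ls; have [e|e] := eqVneq (sR l i) 0; last by lia.
have : sL l.+1 i <> sR l i + 1 by move=> /gn; rewrite e add0r mul1r (negbTE n0).
by lia.
Qed.

(** A slope that is not positive would stay so up to the last bridge, where it is at least
    [r - i]. *)
Lemma sR_gt0 k (i : 'I_r.+1) : (k <= g)%N -> (i < r)%N -> 0 < sR k i.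
Proof.
move=> kg ir; rewrite ltNge; apply/negP => s0.
have := @sR_le0_stays k g i; rewrite kg leqnn => /(_ isT s0).
by have := sR_last i; lia.
Qed.

Lemma ld_mono k : (k <= g)%N -> 0 <= ld k <= deg D.
Proof.
move=> kg; apply/andP; split.
  by apply: le_trans (sR_ge0 ord0 kg) (sR_ld (Ordinal (kg : (k < g.+1)%N)) ord0).
rewrite -ld_deg; apply: (@ord_induction_down (fun l => ld k <= ld l)) kg (lexx _) => j h.
by rewrite ldS; case: (_ != _) => /=; lia.
Qed.

(** Keeping the slope [s] without a chip makes [s * bot_len] congruent to 0, hence [s = 0]: the
    bound of [s] by [ld] keeps it in the range of [eqmod_uniq]. *)
Lemma no_chip_loss (k : 'I_g) i : x_ k = 0 -> 0 < sR k i -> sL k.+1 i < sR k i.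
Proof.
move=> x0 s0; have := loss k i; have := @gain k i; rewrite x0 eqxx /= addr0.
rewrite le_eqVlt => gn /predU1P[e|//]; have := gn e.
have : eqmod_loop L k 0 (0%:~R * bot_len L k).
  by rewrite /eqmod_loop mul0r subrr mul0r; exact: int_num0.
move=> e0 es; have kg : (k <= g)%N by rewrite ltnW.
have := @eqmod_uniq k _ (sR k i) 0 _ es e0; have := ld_mono kg.
have := sR_ld (widen_ord (leqnSn g) k) i => /=; lia.
Qed.

(** The path dominates the slopes of the first [r] functions; the bound by [ld] keeps its
    coordinates in the range where [eqmod_uniq] applies. *)
Definition path_invariant k := [/\ in_chamber (p_ k), forall j, p_ k 0 j <= ld k &
  forall j, sL k (wide j) <= p_ k 0 j].

Lemma path_invariant0 : path_invariant 0.
Proof.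
have sL0 j : sL 0 (wide j) <= p_ 0 0 j by rewrite llp0; exact: sL_first.
split=> //; last by move=> j; rewrite llp0 ld0; lia.
apply/in_chamberP; split=> [j|j j' jj']; last by rewrite !llp0; lia.
apply: lt_le_trans (sL0 j); apply: lt_le_trans (sRL ord0 _).
exact: (sR_gt0 (i := wide j) (leq0n g) (ltn_ord j)).
Qed.

(** Without a chip all coordinates drop by 1, but so do the slopes, at least, and these stay
    positive. With a chip, a slope can overtake coordinate [j] only from equality and if the chip is
    congruent to [(p_j + 1) * bot_len]. No other coordinate satisfies this congruence, and the step
    in direction [j] is allowed, so the path takes it. *)
Lemma path_invariantS (k : 'I_g) : path_invariant k -> path_invariant k.+1.
Proof.
move=> [/in_chamberP[pos dec] ple sLp]; have kg : (k <= g)%N by rewrite ltnW.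
have sRp j : sR k (wide j) <= p_ k 0 j.
  exact: le_trans (sRL (widen_ord (leqnSn g) k) _) (sLp j).
have pd j : 0 < p_ k 0 j <= (2 * g + 3)%:Z.
  by rewrite pos /=; have := ple j; have := ld_mono kg; lia.
have sposS j : 0 < sL k.+1 (wide j).
  have /= := sRL (lift ord0 k) (wide j); rewrite /bump /= add1n; apply: lt_le_trans.
  exact: (sR_gt0 (i := wide j) (ltn_ord k) (ltn_ord j)).
have [_ _ avp] := avoid.
rewrite /path_invariant llpS ldS /llp_step; case: (eqVneq (x_ k) 0) => x0.
  have step j : (p_ k + const_mx (-1)) 0 j = p_ k 0 j - 1 by rewrite !mxE.
  have sle j : sL k.+1 (wide j) <= p_ k 0 j - 1.
    by have := no_chip_loss x0 (sR_gt0 (i := wide j) kg (ltn_ord j)); have := sRp j; lia.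
  split=> [|j|j]; rewrite ?step //; last by have := ple j; lia.
  apply/in_chamberP; split=> [j|j j' jj']; rewrite !step.
    by apply: lt_le_trans (sle j).
  by have := dec _ _ jj'; lia.
have gainE j : p_ k 0 j < sL k.+1 (wide j) ->
    eqmod_loop L k (x_ k) ((p_ k 0 j + 1)%:~R * bot_len L k) /\ sL k.+1 (wide j) = p_ k 0 j + 1.
  move=> lt1; have := loss k (wide j); have := @gain k (wide j).
  rewrite x0 /= => gn ls; have := sRp j => le1.
  have e : sR k (wide j) = p_ k 0 j by lia.
  by rewrite -e; split; [apply: gn; lia|lia].
case: pickP => [j0 /and3P[ej0 _ ch]|nostep].
  have step j : (p_ k + delta_mx 0 j0) 0 j = p_ k 0 j + (j == j0)%:Z.
    by rewrite !mxE eqxx /=; case: eqP.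
  split=> // j; rewrite step; first by have := ple j; case: eqP => /=; lia.
  case: eqP => [->|jj0] /=; rewrite ?addr0.
    by have := loss k (wide j0); rewrite x0 /=; have := sRp j0; lia.
  rewrite leNgt; apply/negP => /gainE[ej _]; apply: jj0.
  have pp : p_ k 0 j + 1 = p_ k 0 j0 + 1.
    by apply: (@eqmod_uniq k (x_ k)) => //; have := pd j; have := pd j0; lia.
  apply/val_inj; case: (ltngtP j j0) => // /dec; lia.
rewrite addr0; split=> [|j|j].
- exact/in_chamberP.
- by have := ple j; rewrite /=; lia.
rewrite leNgt; apply/negP => /gainE[ej _].
have := nostep j; rewrite /can_step ej /= => /negbT/negP; apply.
apply/andP; split; first exact/in_chamberP.
have step i : (p_ k + delta_mx 0 j) 0 i = p_ k 0 i + (i == j)%:Z.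
  by rewrite !mxE eqxx /=; case: eqP.
apply/in_chamberP; split=> [i|a b ab]; rewrite !step.
  by have := pos i; case: (i == j) => /=; lia.
(* The step could leave the chamber only if an earlier coordinate equals [p_j + 1]. The chip would
   then be congruent to that coordinate times [bot_len], which vertex avoidance excludes. *)
have := dec a b ab; case: (eqVneq b j) => [bj|_]; last by case: (a == j) => /=; lia.
have -> : (a == j) = false by apply/negbTE; rewrite -val_eqE /=; subst b; rewrite neq_ltn ab.
subst b; rewrite /= addr0 => lt1; rewrite lt_neqAle; apply/andP; split; last by lia.
by apply: contraTneq ej => ->; exact: avp.
Qed.

Lemma path_invariantP k : (k <= g)%N -> path_invariant k.
Proof.
elim: k => [|k IH] kg; first exact: path_invariant0.
exact: (@path_invariantS (Ordinal kg)) (IH (ltnW kg)).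
Qed.

(** One formula for the three kinds of steps, which change the sum by [-r], [1] and [0]. *)
Lemma sum_llpS (k : 'I_g) : \sum_j p_ k.+1 0 j =
  \sum_j p_ k 0 j - r%:Z + (r.+1)%:Z * chip k - (lingers D k (p_ k))%:Z.
Proof.
rewrite llpS (eq_bigr (fun j => p_ k 0 j + llp_step D k (p_ k) 0 j)); last first.
  by move=> j _; rewrite mxE.
rewrite big_split /= -!addrA; congr (_ + _); rewrite /llp_step /lingers.
case: (eqVneq (x_ k) 0) => x0 /=.
  rewrite (eq_bigr (fun=> -1)); last by move=> j _; rewrite mxE.
  by rewrite sumr_const card_ord; lia.
case: pickP => [j0 cj0|nostep].
  rewrite (_ : [exists j, _] = true); last by apply/existsP; exists j0.
  rewrite (bigD1 j0) //= mxE !eqxx big1 ?addr0; first by lia.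
  by move=> j /negbTE jj0; rewrite mxE jj0 andbF.
rewrite (_ : [exists j, _] = false); last by apply/existsP => -[j]; rewrite nostep.
by rewrite big1; [lia|move=> j _; rewrite mxE].
Qed.

(** The changes telescope, and since exactly [rho] steps linger, the terms with [g] and [deg D]
    cancel. *)
Lemma sum_llp_last : \sum_j p_ g 0 j = \sum_j p_ 0 0 j +
  (r.+1)%:Z * (r%:Z - coeff (w_ L ord0) D).
Proof.
have tele k : (k <= g)%N -> \sum_j p_ k 0 j = \sum_j p_ 0 0 j - r%:Z * k%:Z
    + (r.+1)%:Z * (ld k - ld 0) - \sum_(i < g | (i < k)%N) (lingers D i (p_ i))%:Z.
  elim: k => [|k IH] kg; first by rewrite [X in _ = _ - X]big_pred0 //; ring.
  rewrite (sum_llpS (Ordinal kg)) IH 1?ltnW // (ldS (Ordinal kg)) /=.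
  rewrite [X in _ = _ - X](bigD1 (Ordinal kg)) ?leqnn //=.
  rewrite [X in _ - (_ + X)](eq_bigl (fun i : 'I_g => (i < k)%N)); last first.
    by move=> i; rewrite -val_eqE /= ltnS; case: ltngtP.
  by rewrite [k.+1%:Z]intS; ring.
have [av _ _] := avoid; rewrite (tele g (leqnn g)) ld_deg ld0.
rewrite [X in _ - X](eq_bigl xpredT) => [|i]; last by rewrite ltn_ord.
have -> : \sum_(i < g) (lingers D i (p_ i))%:Z = rho g r (deg D).
  rewrite -av -sum1dep_card (big_morph Posz PoszD (erefl _)) [RHS]big_mkcond.
  by apply: eq_bigr => i _; case: lingers.
by rewrite /rho intS; ring.
Qed.

(** For [>=], the first slope of the last function lies between 0 and [d_0 - r]. For [<=], the
    coordinates of [p_g] are at least [r - j], and comparing sums through [sum_llp_last] leaves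
    [0 <= r - d_0]. *)
Lemma chip0_eq : coeff (w_ L ord0) D = r%:Z.
Proof.
apply/eqP; rewrite eq_le; apply/andP; split; last first.
  have := sL_first ord_max; have := sRL ord0 ord_max; have := sR_ge0 ord_max (leq0n g).
  by rewrite /=; lia.
have [_ _ sLp] := path_invariantP (leqnn g).
have : \sum_(j < r) (r%:Z - (j : nat)%:Z) <= \sum_j p_ g 0 j.
  apply: ler_sum => j _; apply: le_trans (sLp j); apply: le_trans (sRL ord_max _).
  by have := sR_last (wide j); rewrite /=; have := ltn_ord j; lia.
rewrite sum_llp_last [X in _ <= X + _](eq_bigr
  (fun j : 'I_r => coeff (w_ L ord0) D - (j : nat)%:Z)); last first.
  by move=> j _; rewrite llp0.
rewrite !sumrB !sumr_const card_ord !pmulrn !mulrzz intS.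
rewrite -subr_ge0 -[coeff _ _ <= _]subr_ge0; set S := \sum_(i < r) _.
by congr (0 <= _); ring.
Qed.

(** Each coordinate is at least [r - j], which is its value in [p_0], and the coordinates of [p_g]
    and [p_0] have the same sum. *)
Lemma llp_last j : p_ g 0 j = r%:Z - (j : nat)%:Z.
Proof.
have [_ _ sLp] := path_invariantP (leqnn g).
have le1 (i : 'I_r) : r%:Z - (i : nat)%:Z <= p_ g 0 i.
  apply: le_trans (sLp i); apply: le_trans (sRL ord_max _).
  by have := sR_last (wide i); rewrite /=; have := ltn_ord i; lia.
have := sum_llp_last; rewrite chip0_eq subrr mulr0 addr0.
rewrite (eq_bigr (fun j => p_ 0 0 j + (p_ g 0 j - p_ 0 0 j))); last by move=> i _; lia.
rewrite big_split /= -[RHS]addr0 => /addrI/eqP.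
rewrite psumr_eq0 => [|i _]; last by rewrite llp0 chip0_eq subr_ge0.
by move=> /allP/(_ j (mem_index_enum _))/eqP; rewrite llp0 chip0_eq; lia.
Qed.

(* If the slope were below the path somewhere, it would stay below it. *)
Lemma llp_le_sR k j : (k <= g)%N -> p_ k 0 j <= sR k (wide j).
Proof.
move=> kg; rewrite leNgt; apply/negP => lt1.
suff : sR g (wide j) < p_ g 0 j.
  by rewrite llp_last; have := sR_last (wide j); have := ltn_ord j => /=; lia.
apply: (@ord_induction_down (fun k => sR k (wide j) < p_ k 0 j)) kg lt1 => {}k lt1.
have [_ _ avp] := avoid; have kg : (k <= g)%N by rewrite ltnW.
have /= := sRL (lift ord0 k) (wide j); rewrite /bump /= add1n => sRLk.
apply: le_lt_trans sRLk _; rewrite llpS /llp_step.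
case: (eqVneq (x_ k) 0) => x0.
  have -> : (p_ k + const_mx (-1)) 0 j = p_ k 0 j - 1 by rewrite !mxE.
  by have := no_chip_loss x0 (sR_gt0 (i := wide j) kg (ltn_ord j)); lia.
have lt2 : sL k.+1 (wide j) < p_ k 0 j.
  have := loss k (wide j); have := @gain k (wide j); rewrite x0 /= => gn ls.
  case: (ltgtP (sL k.+1 (wide j)) (p_ k 0 j)) => //; first by lia.
  move=> e; have e' : sR k (wide j) + 1 = p_ k 0 j by lia.
  by have := gn _; rewrite e' (negbTE (avp k j)) => ->.
case: pickP => [j0 _|_]; rewrite ?addr0 //.
by rewrite !mxE eqxx /=; case: (j == j0) => /=; lia.
Qed.

(** This slope starts at most at [d_0 - r = 0], is never negative, and could leave 0 only at a chip
    congruent to [bot_len]. *)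
Lemma slope_last k : (k <= g)%N -> sL k ord_max = 0 /\ sR k ord_max = 0.
Proof.
elim: k => [|k IH] kg.
  have := sRL ord0 ord_max; have := sR_ge0 ord_max kg; have := sL_first ord_max.
  by rewrite chip0_eq /=; lia.
have [_ sR0] := IH (ltnW kg); have := sR_ge0 ord_max kg.
have := sRL (Ordinal (kg : (k.+1 < g.+1)%N)) ord_max => /=.
have := loss (Ordinal kg) ord_max; have := @gain (Ordinal kg) ord_max.
have [_ avm _] := avoid; have := avm (Ordinal kg).
rewrite /= sR0 add0r; case: eqP => x0 /=; first by lia.
rewrite mul1r => /negbTE -> gn ls.
have : sL k.+1 ord_max <> 1 by move=> /gn.
by lia.
Qed.

(** The chain [p <= sR <= sL <= p] collapses. *)
Lemma slope_llp k j : (k <= g)%N ->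
  sL k (wide j) = p_ k 0 j /\ sR k (wide j) = p_ k 0 j.
Proof.
move=> kg; have [_ _ /(_ j) le1] := path_invariantP kg; have := llp_le_sR j kg.
by have /= := sRL (Ordinal (kg : (k < g.+1)%N)) (wide j); lia.
Qed.

Lemma ord_lastP (i : 'I_r.+1) : i = ord_max \/ exists j, i = wide j.
Proof.
case: (ltnP i r) => ir; [right; exists (Ordinal ir)|left]; apply: val_inj => //=.
by have := ltn_ord i; lia.
Qed.

Lemma slope_eq k i : (k <= g)%N -> sL k i = sR k i.
Proof.
move=> kg; case: (ord_lastP i) => [->|[j ->]].
  by have [-> ->] := slope_last kg.
by have [-> ->] := slope_llp j kg.
Qed.

(** The first [r] slopes are the coordinates of a point of the chamber, so they are distinct and
    positive; the last one is 0. *)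
Lemma slope_inj k : (k <= g)%N -> injective (sL k).
Proof.
move=> kg i i'; have [/in_chamberP[pos dec] _ _] := path_invariantP kg.
case: (ord_lastP i) => [->|[j ->]]; case: (ord_lastP i') => [->//|[j' ->]].
- by rewrite (slope_last kg).1 (slope_llp j' kg).1; have := pos j'; lia.
- by rewrite (slope_last kg).1 (slope_llp j kg).1; have := pos j; lia.
rewrite (slope_llp j kg).1 (slope_llp j' kg).1 => e; congr (wide _); apply: val_inj.
by case: (ltngtP j j') => // /dec; lia.
Qed.

Lemma slope_ends (i : 'I_r.+1) : sL 0 i = (r - i)%N%:Z /\ sR g i = (r - i)%N%:Z.
Proof.
case: (ord_lastP i) => [->|[j ->]] /=.
  by rewrite (slope_last (leq0n g)).1 (slope_last (leqnn g)).2 subnn.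
rewrite (slope_llp j (leq0n g)).1 (slope_llp j (leqnn g)).2 llp_last llp0 chip0_eq.
by have := ltn_ord j; lia.
Qed.

(** Full gain means that the divisor of index [i] has no chip on the loop. Two such indices satisfy
    the same congruence, so their slopes agree. *)
Lemma full_gain_uniq (k : 'I_g) i i' : sL k.+1 i = sR k i + chip k ->
  sL k.+1 i' = sR k i' + chip k -> i = i'.
Proof.
have kg : (k <= g)%N by rewrite ltnW.
move=> e e'; apply: (slope_inj kg); rewrite !slope_eq //.
have := eqmod_uniq _ (gain e) (gain e').
have := sR_ge0 i kg; have := sR_ge0 i' kg; have := ld_mono kg.
have /= := sR_ld (widen_ord (leqnSn g) k) i.
have /= := sR_ld (widen_ord (leqnSn g) k) i'; lia.
Qed.

End LatticePath.

(** * Tropical independence *)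

Section Representatives.
Variables (R : realType) (g : nat) (L : chain_lengths R g) (r : nat).
Local Notation C := (chain_of_loops L).
Variables (D : divisor C) (D_ : 'I_r.+1 -> divisor C).
Hypothesis redD : reduced_at (w_ L ord0) D.
Hypothesis avoid : vertex_avoiding r D.
Hypothesis D_equiv : forall i, lin_equiv D (D_ i).
Hypothesis D_ends : forall i : 'I_r.+1,
  effective (D_ i - << w_ L ord0 >> *+ i - << v_succ L ord_max >> *+ (r - i)).

(** With [D_ i = D + div psi_i], this is the slope of [psi_i] at the left end ([n = 2 * k]) or right
    end ([n = 2 * k + 1]) of the bridge from [w_k]. *)
Definition slope (n : nat) (i : 'I_r.+1) : int := ldeg n D - ldeg n (D_ i).

Lemma coeff_D_ends (i : 'I_r.+1) p : (i * (p == w_ L ord0))%N%:Z +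
  ((r - i) * (p == v_succ L ord_max))%N%:Z <= coeff p (D_ i).
Proof.
have /effectiveP/(_ p) := D_ends i.
rewrite !coeffB !coeffMn !coeffU !mul1r ![_ == p]eq_sym !natz !pmulrn !mulrzz.
by case: (_ == _); case: (_ == _); rewrite ?mul1r ?mul0r ?muln1 ?muln0; lia.
Qed.

Lemma D_effective i : effective (D_ i).
Proof. by apply/fgposP => p; apply: le_trans (coeff_D_ends i p). Qed.

Lemma zone_bridgeP (p : point C) (k : nat) : zone p = (2 * k + 1)%N ->
  exists (j : 'I_g.+1) t, [/\ j = k :> nat, 0 < t <= bridge_len L j & p = edge_pt (bridge L j) t].
Proof.
case: p => [[j|j]|[[[[j|j]|j] t] h]] /= jk; try by lia.
exists j, t; have /= /andP[t0 tl] := h; split; [by lia|by rewrite t0 ltW|].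
by rewrite (edge_pt_in (e := bridge L j) h).
Qed.

Lemma coeff_bridge p k : zone p = (2 * k + 1)%N -> coeff p D = 0.
Proof. by move=> /zone_bridgeP[j [t [_ ht ->]]]; exact: reduced_bridge. Qed.

Lemma zdeg_bridge0 k : zdeg (2 * k + 1) D = 0.
Proof.
apply: wdeg_eq0 => p; case: eqP => [zp|_]; last by rewrite mul0rz.
by rewrite (coeff_bridge zp) mulr0z.
Qed.

Lemma coeff_v_last : coeff (v_succ L ord_max) D = 0.
Proof.
rewrite -(reduced_bridge redD (k := ord_max) (t := bridge_len L ord_max)).
  by rewrite edge_pt_tgt.
by rewrite lexx bridge_len_gt0.
Qed.

Lemma ldeg_chip (k : 'I_g) : ldeg (2 * k.+1) D = ldeg (2 * k) D + (chip_pos D k != 0)%:Z.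
Proof. by rewrite ldeg_loop ldeg_bridge zdeg_bridge0 addr0 (zdeg_chip redD). Qed.

Lemma ldeg_last : ldeg (2 * g) D = deg D.
Proof.
by rewrite deg_ldeg ldeg_loop ldeg_bridge zdeg_last zdeg_bridge0 coeff_v_last !addr0.
Qed.

Lemma slope_bridge k i : slope (2 * k + 1) i = slope (2 * k) i - zdeg (2 * k + 1) (D_ i).
Proof. by rewrite /slope !ldeg_bridge zdeg_bridge0; lia. Qed.

Lemma slope_loop (k : 'I_g) i : slope (2 * k.+1) i =
  slope (2 * k + 1) i + (chip_pos D k != 0)%:Z - zdeg (2 * k + 2) (D_ i).
Proof. by rewrite /slope !ldeg_loop (zdeg_chip redD); lia. Qed.

Lemma deg_D_ i : deg (D_ i) = deg D.
Proof.
have [psi psiE] := D_equiv i; have [c [_ _ _]] := chain_flow psiE.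
by rewrite degB => /eqP; rewrite subr_eq0 => /eqP.
Qed.

(** This and the following local facts discharge the hypotheses on the lattice path, with
    [slope (2 * k)], [slope (2 * k + 1)] and [ldeg (2 * k) D] for [sL k], [sR k] and [ld k]. *)
Let x_range (k : 'I_g) : 0 <= chip_pos D k < loop_len L k.
Proof. by have [] := chip_posP redD k. Qed.

Let sRL (k : 'I_g.+1) i : slope (2 * k + 1) i <= slope (2 * k) i.
Proof. by rewrite slope_bridge; have := zdeg_ge0 (2 * k + 1) (D_effective i); lia. Qed.

Let loss (k : 'I_g) i : slope (2 * k.+1) i <= slope (2 * k + 1) i + (chip_pos D k != 0)%:Z.
Proof. by rewrite slope_loop; have := zdeg_ge0 (2 * k + 2) (D_effective i); lia. Qed.

Let gain (k : 'I_g) i : slope (2 * k.+1) i = slope (2 * k + 1) i + (chip_pos D k != 0)%:Z ->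
  eqmod_loop L k (chip_pos D k)
    ((slope (2 * k + 1) i + (chip_pos D k != 0)%:Z)%:~R * bot_len L k).
Proof.
rewrite slope_loop => z0; have [psi psiE] := D_equiv i.
by apply: (loop_rule redD (D_effective i) psiE); lia.
Qed.

Let sL_first (i : 'I_r.+1) : slope (2 * 0) i <= coeff (w_ L ord0) D - (i : nat)%:Z.
Proof.
by rewrite /slope muln0 !ldeg0; have := coeff_D_ends i (w_ L ord0); rewrite eqxx; lia.
Qed.

(** The degrees agree, so the chips that [D_ i] lacks before [v_{g+1}] are those at [v_{g+1}], where
    [D] has none. *)
Let sR_last (i : 'I_r.+1) : (r - i)%N%:Z <= slope (2 * g + 1) i.
Proof.
have := deg_D_ i; rewrite !deg_ldeg !ldeg_loop !zdeg_last coeff_v_last /slope.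
by have := coeff_D_ends i (v_succ L ord_max); rewrite eqxx; lia.
Qed.

Let sR_ld (k : 'I_g.+1) i : slope (2 * k + 1) i <= ldeg (2 * k) D.
Proof.
rewrite /slope ldeg_bridge zdeg_bridge0.
by have := ldeg_ge0 (2 * k + 1) (D_effective i); lia.
Qed.

Let ld0 : ldeg (2 * 0) D = coeff (w_ L ord0) D.
Proof. by rewrite muln0 ldeg0. Qed.

Hypothesis deg_small : deg D <= (2 * g + 3)%:Z.
Hypothesis small : forall k : 'I_g, (2 * g + 3)%:R * bot_len L k < loop_len L k.

Lemma chip0 : coeff (w_ L ord0) D = r%:Z.
Proof.
exact: (@chip0_eq _ _ _ _ _ small (fun k => slope (2 * k)) (fun k => slope (2 * k + 1))
  (fun k => ldeg (2 * k) D) x_range sRL loss gain sL_first sR_last sR_ld ld0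
  ldeg_chip ldeg_last deg_small avoid).
Qed.

Lemma zdeg_bridge_D_ k i : (k <= g)%N -> zdeg (2 * k + 1) (D_ i) = 0.
Proof.
move=> kg; suff : slope (2 * k) i = slope (2 * k + 1) i by rewrite slope_bridge; lia.
exact: (@slope_eq _ _ _ _ _ small (fun k => slope (2 * k)) (fun k => slope (2 * k + 1))
  (fun k => ldeg (2 * k) D) x_range sRL loss gain sL_first sR_last sR_ld ld0
  ldeg_chip ldeg_last deg_small avoid).
Qed.

Lemma slope_injective k : (k <= g)%N -> injective (slope (2 * k)).
Proof.
exact: (@slope_inj _ _ _ _ _ small (fun k => slope (2 * k)) (fun k => slope (2 * k + 1))
  (fun k => ldeg (2 * k) D) x_range sRL loss gain sL_first sR_last sR_ld ld0
  ldeg_chip ldeg_last deg_small avoid).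
Qed.

Lemma slope_ge0 k i : (k <= g)%N -> 0 <= slope (2 * k) i.
Proof.
move=> kg; apply: le_trans (sRL (Ordinal (kg : (k < g.+1)%N)) i).
exact: (@sR_ge0 _ _ _ _ _ (fun k => slope (2 * k)) (fun k => slope (2 * k + 1))
  (fun k => ldeg (2 * k) D) x_range sRL loss gain sR_last ld0 ldeg_last deg_small).
Qed.

Lemma slope_first_last (i : 'I_r.+1) : slope 0 i = (r - i)%N%:Z /\ slope (2 * g) i = (r - i)%N%:Z.
Proof.
have [e0 eg] := @slope_ends _ _ _ _ _ small (fun k => slope (2 * k))
  (fun k => slope (2 * k + 1)) (fun k => ldeg (2 * k) D) x_range sRL loss gain
  sL_first sR_last sR_ld ld0 ldeg_chip ldeg_last deg_small avoid i.
split; first by rewrite -[0%N](muln0 2).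
by rewrite -eg slope_bridge zdeg_bridge_D_ // subr0.
Qed.

Lemma zdeg_loop_D_ (k : 'I_g) i : zdeg (2 * k + 2) (D_ i) =
  slope (2 * k) i + (chip_pos D k != 0)%:Z - slope (2 * k.+1) i.
Proof.
by rewrite slope_loop slope_bridge zdeg_bridge_D_ ?subr0; [lia|rewrite ltnW].
Qed.

Lemma zdeg_loop_D_eq0 (k : 'I_g) i i' : zdeg (2 * k + 2) (D_ i) = 0 ->
  zdeg (2 * k + 2) (D_ i') = 0 -> i = i'.
Proof.
move=> z z'; apply: (@full_gain_uniq _ _ _ _ _ small (fun k => slope (2 * k))
  (fun k => slope (2 * k + 1)) (fun k => ldeg (2 * k) D) x_range sRL loss gain
  sL_first sR_last sR_ld ld0 ldeg_chip ldeg_last deg_small avoid k);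
  by rewrite /= slope_loop; lia.
Qed.

End Representatives.

(** If a weightless element occurs, both lists consist of copies of it and at most one other
    element, which the sum of [sigma] determines. Otherwise all weights that occur are at least 1
    and the lists have length one. *)
Lemma perm_eq_light_multisets (T : eqType) (w sigma : T -> int) (s s' : seq T) :
  (forall i, 0 <= w i) -> (forall i j, w i = 0 -> w j = 0 -> i = j) ->
  injective sigma -> (0 < size s)%N -> size s = size s' ->
  \sum_(i <- s) w i <= 1 -> \sum_(i <- s') w i <= 1 ->
  \sum_(i <- s) sigma i = \sum_(i <- s') sigma i -> perm_eq s s'.
Proof.
move=> w0 wz sinj s0 ss' hs hs' e.
have sumw_ge0 (u : seq T) : 0 <= \sum_(i <- u) w i by apply: sumr_ge0.
(* A list of total weight at most 1 repeats the weightless element, with at most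
   one exception. *)
have shape (j : T) (u : seq T) : w j = 0 -> (0 < size u)%N -> \sum_(i <- u) w i <= 1 ->
    exists i, perm_eq u (i :: nseq (size u).-1 j).
  move=> wj; elim: u => // i u IH _; rewrite big_cons => le1.
  case: (posnP (size u)) => [/size0nil ->|u0]; first by exists i.
  have [wi|wi] := eqVneq (w i) 0.
    have [|i' pu] := IH u0; first by move: le1; rewrite wi add0r.
    exists i'; rewrite (wz _ _ wi wj) /=.
    rewrite -(perm_cons j) in pu; apply: (perm_trans pu).
    rewrite -[in X in perm_eq _ X](prednK u0) /= -cat1s -(cat1s i') -[j :: nseq _ _]cat1s.
    by rewrite perm_catCA.
  exists i; rewrite perm_cons /=.
  have uz : \sum_(a <- u) w a = 0.
    move: (sumw_ge0 u) le1 (w0 i) wi; move: (\sum_(a <- u) w a) (w i) => x y; lia.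
  have /all_pred1P uE : all (pred1 j) u; last by rewrite -uE perm_refl.
  apply/allP => a au /=; apply/eqP; apply: (wz _ _ _ wj).
  move: (sumw_ge0 (rem a u)) (w0 a) uz; rewrite (perm_big _ (perm_to_rem au)) /= big_cons.
  by move: (\sum_(a <- _) w a) (w a) => x y; lia.
case: (boolP (has (fun i => w i == 0) (s ++ s'))) => [/hasP[j _ /eqP wj]|nz].
  have [i pi] := shape j s wj s0 hs; have [|i' pi'] := shape j s' wj _ hs'.
    by rewrite -ss'.
  apply: (perm_trans pi); rewrite perm_sym; apply: (perm_trans pi').
  move: e; rewrite (perm_big _ pi) (perm_big _ pi') /= !big_cons ss' => /addIr/sinj ->.
  exact: perm_refl.
have w1 i : i \in s ++ s' -> 1 <= w i.
  by move=> is_; move/hasPn: nz => /(_ i is_); have := w0 i; lia.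
have size1 (u : seq T) : {subset u <= s ++ s'} -> (size u)%:Z <= \sum_(i <- u) w i.
  elim: u => [|a u IH] sub; first by rewrite big_nil.
  rewrite big_cons /= intS; apply: lerD; first exact: w1 (sub _ (mem_head _ _)).
  by apply: IH => x xu; apply: sub; rewrite inE xu orbT.
have s1 : size s = 1%N.
  have ss : {subset s <= s ++ s'} by move=> x xs; rewrite mem_cat xs.
  by have := le_trans (size1 s ss) hs; lia.
case: s s1 ss' e {s0 hs nz w1 size1} => [|a [|]] // _.
by case: s' {hs'} => [|b [|]] // _; rewrite !big_seq1 => /sinj ->; exact: perm_refl.
Qed.

(** Slopes of minimizers do not increase to the right, and two minimizers at the same point have
    distinct slopes. So further right there is always a minimizer of strictly smaller slope; moving
    right [n] times shows that the slope at the start was at least [n], for every [n]. *)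
Lemma no_double_min (R : realType) (T : Type) (f : T -> R -> R) (s : T -> int) (u v : R) :
  u < v -> (forall t, 0 <= s t) ->
  (forall t x y, u < x < v -> u < y < v -> f t y = f t x + (s t)%:~R * (y - x)) ->
  (forall x, u < x < v -> exists t t', [/\ t <> t', forall a, f t x <= f a x &
     forall a, f t' x <= f a x]) ->
  (forall x t t', u < x < v -> (forall a, f t x <= f a x) ->
     (forall a, f t' x <= f a x) -> s t = s t' -> t = t') -> False.
Proof.
move=> uv s0 lin dbl inj.
have grow (n : nat) x t : u < x < v -> (forall a, f t x <= f a x) -> n%:Z <= s t.
  elim: n x t => [|n IH] x t hx mt; first exact: s0.
  pose y := (x + v) / 2; have hy : u < y < v by rewrite /y; lra.
  have xy : x < y by rewrite /y; lra.
  have le_s t' : (forall a, f t' y <= f a y) -> s t' <= s t.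
    move=> mt'; rewrite -(ler_int R) -(@ler_pM2r _ (y - x)) ?subr_gt0 //.
    have := mt' t; have := mt t'; rewrite (lin t x y) // (lin t' x y) //; lra.
  have [t1 [t2 [ne m1 m2]]] := dbl y hy.
  have ne_s : s t1 <> s t2 by move=> /(inj y t1 t2 hy m1 m2).
  have := IH y t1 hy m1; have := IH y t2 hy m2; have := le_s t1 m1; have := le_s t2 m2.
  by lia.
pose x := (u + v) / 2; have hx : u < x < v by rewrite /x; lra.
have [t [t' [_ mt _]]] := dbl x hx.
by have := grow (`|s t|%N.+1) x t hx mt; have := s0 t; lia.
Qed.

Theorem theorem5p3 (R : realType) (g : nat) (L : chain_lengths R g)
    (m r : nat) (d : int) (D : divisor (chain_of_loops L))
    (D_ : 'I_r.+1 -> divisor (chain_of_loops L))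
    (psi : multisets r m -> plfun (chain_of_loops L)) :
  (1 <= m)%N ->
  admissible L m ->
  reduced_at (w_ L ord0) D ->
  deg D = d ->
  has_rank D r ->
  vertex_avoiding r D ->
  (forall i : 'I_r.+1, lin_equiv D (D_ i) /\
     effective (D_ i - << w_ L ord0 >> *+ i - << v_succ L ord_max >> *+ (r - i))) ->
  (forall I : multisets r m,
     is_div (psi I) ((\sum_(i <- val I) D_ i) - D *+ m)) ->
  m%:Z * d < (2 * g + 4)%:Z ->
  trop_independent psi.
Proof.
move=> m1 [adm1 adm2 _] redD degD _ avoid D_h psiE mdd [b dep].
have D_equiv i : lin_equiv D (D_ i) by case: (D_h i).
have D_ends i : effective
    (D_ i - << w_ L ord0 >> *+ i - << v_succ L ord_max >> *+ (r - i)) by case: (D_h i).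
have md_small : m%:Z * deg D <= (2 * g + 3)%:Z by rewrite degD; lia.
have deg_small : deg D <= (2 * g + 3)%:Z.
  have [d0|d0] := leP (deg D) 0; first by lia.
  by apply: le_trans md_small; rewrite ler_peMl // ?ltW // lez_nat.
(* [2 * g + 2] bounds the factor [m * deg D - 1] that [loop_variation] will produce. It is at most
   [4 * g] because there is a loop. *)
have gm (k : 'I_g) : (2 * g + 2)%:R * bot_len L k <= (4 * g)%:R * bot_len L k.
  by rewrite ler_pM2r ?bot_len_gt0 // ler_nat; have := ltn_ord k; lia.
have small (k : 'I_g) : (2 * g + 3)%:R * bot_len L k < loop_len L k.
  rewrite (_ : 2 * g + 3 = (2 * g + 2) + 1)%N; last by lia.
  rewrite natrD mulrDl mul1r /loop_len ltrD2r.
  exact: le_lt_trans (gm k) (adm1 k).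
(* [S I n] is the slope of [psi I] on the bridge from [w_n], as [lin] shows. *)
pose sl := slope D D_; pose S I n := \sum_(i <- val (I : multisets r m)) sl (2 * n)%N i.
pose DI I := \sum_(i <- val (I : multisets r m)) D_ i.
have sizeI (I : multisets r m) : size (val I) = m by case: I => I /= /eqP.
have D_eff i : effective (D_ i) := D_effective D_ends i.
have sum_const (I : multisets r m) (c : int) : \sum_(i <- val I) c = m%:Z * c.
  suff sum_seq (s : seq 'I_r.+1) : \sum_(i <- s) c = (size s)%:Z * c by rewrite sum_seq sizeI.
  elim: s => [|a s IH]; first by rewrite big_nil mul0r.
  by rewrite big_cons IH /= intS mulrDl mul1r.
have DI_eff I : effective (DI I).
  apply/fgposP => p; rewrite raddf_sum; apply: sumr_ge0 => i _.
  exact: effectiveP.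
have DI_deg I : deg (DI I) = m%:Z * deg D.
  rewrite raddf_sum -(sum_const I); apply: eq_bigr => i _; exact: deg_D_.
have lin I (k : 'I_g.+1) (t : R) : 0 <= t <= bridge_len L k ->
    psi I (edge_pt (bridge L k) t) = psi I (w_ L k) + (S I k)%:~R * t.
  move=> ht; have kg : (k <= g)%N by rewrite -ltnS.
  rewrite (bridge_linear (psiE I)) // => [|p zp].
    congr (_ + _); rewrite -mulNr -rmorphN; congr (_%:~R * _).
    rewrite ldegB /ldeg wdegMn wdeg_sum /S /sl /slope sumrB sum_const /ldeg.
    by rewrite opprB pmulrn mulrzz mulrC.
  rewrite coeffB coeffMn (coeff_bridge redD zp) mul0rn subr0.
  apply: (coeff_zdeg0 (DI_eff I)) zp; rewrite /zdeg wdeg_sum big1 // => i _.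
  exact: (zdeg_bridge_D_ redD avoid D_equiv D_ends deg_small small).
pose F I k t := psi I (edge_pt (bridge L k) t) + b I.
have FL I k (x y : R) : 0 <= x <= bridge_len L k -> 0 <= y <= bridge_len L k ->
    F I k y = F I k x + (S I k)%:~R * (y - x).
  by move=> hx hy; rewrite /F !lin //; ring.
have S_ge0 I k : (k <= g)%N -> 0 <= S I k.
  move=> kg; apply: sumr_ge0 => i _.
  exact: (slope_ge0 redD D_equiv D_ends deg_small).
have eqI (I I' : multisets r m) : perm_eq (val I) (val I') -> I = I'.
  move=> pI; apply: val_inj; rewrite -[LHS]seq_mset_id -[RHS]seq_mset_id.
  exact/eq_seq_msetP.
(* If all minimizers on a segment of a bridge are light for a weight with at most one zero, then
   those tied at a point differ in slope, and double minima cannot persist. *)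
have key (k : 'I_g.+1) (u v : R) (w : 'I_r.+1 -> int) :
    0 <= u -> u < v -> v <= bridge_len L k -> (forall i, 0 <= w i) ->
    (forall i j, w i = 0 -> w j = 0 -> i = j) ->
    (forall x I, u < x < v -> (forall I', F I k x <= F I' k x) ->
      \sum_(i <- val I) w i <= 1) -> False.
  move=> u0 uv vn w0 wz light; have kg : (k <= g)%N by rewrite -ltnS.
  apply: (@no_double_min R (multisets r m) (fun I => F I k) (fun I => S I k) u v) => //.
  - by move=> I; exact: S_ge0.
  - by move=> I x y hx hy; apply: FL; lra.
  - by move=> x _; have [I [I' [ne h h']]] := dep (edge_pt (bridge L k) x); exists I, I'.
  move=> x I I' hx hI hI' eS; apply: eqI.
  apply: (perm_eq_light_multisets w0 wz (sigma := sl (2 * k)%N)) => //.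
  - exact: (slope_injective redD avoid D_equiv D_ends deg_small small).
  - by rewrite sizeI.
  - by rewrite !sizeI.
  - exact: light hI.
  - exact: light hI'.
pose mid k := bridge_len L k / 2.
have n0 k : 0 < bridge_len L k := bridge_len_gt0 L k.
have /choice[J minJ] (k : 'I_g.+1) : exists J, forall I, F J k (mid k) <= F I k (mid k).
  by have [I [_ [_ h _]]] := dep (edge_pt (bridge L k) (mid k)); exists I.
(* A minimum of affine functions is concave, so slopes of minimizers to the right of the middle are
   at most that of [J k], and those to the left at least. *)
have right_le (k : 'I_g.+1) x I : mid k < x <= bridge_len L k ->
    (forall I', F I k x <= F I' k x) -> S I k <= S (J k) k.
  move=> hx hI; have hm : 0 <= mid k <= bridge_len L k by have := n0 k; rewrite /mid; lra.
  have h0 : 0 <= x <= bridge_len L k by lra.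
  rewrite -(ler_int R) -(@ler_pM2r _ (x - mid k)); last by lra.
  have := hI (J k); have := minJ k I; rewrite !(FL _ k (mid k) x) //; lra.
have left_ge (k : 'I_g.+1) x I : 0 <= x < mid k ->
    (forall I', F I k x <= F I' k x) -> S (J k) k <= S I k.
  move=> hx hI; have hm : 0 <= mid k <= bridge_len L k by have := n0 k; rewrite /mid; lra.
  have h0 : 0 <= x <= bridge_len L k by lra.
  rewrite -(ler_int R) -(@ler_pM2r _ (mid k - x)); last by lra.
  have := hI (J k); have := minJ k I; rewrite !(FL _ k (mid k) x) //; lra.
have ends i := slope_first_last redD avoid D_equiv D_ends deg_small small i.
have first_piece : 2 <= m%:Z * r%:Z - S (J ord0) 0.
  rewrite leNgt; apply/negP => lt2.
  (* The weight [i] is the number of chips of [D_ i] at [w_0], since its slope there is [r - i]. *)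
  apply: (key ord0 0 (mid ord0) (fun i : 'I_r.+1 => (i : nat)%:Z)) => //.
  - by rewrite /mid divr_gt0.
  - by have := n0 ord0; rewrite /mid; lra.
  - by move=> i j /eqP i0 /eqP j0; apply: val_inj; move: i0 j0; rewrite /=; lia.
  move=> x I hx hI; have hx' : 0 <= x < mid ord0 by lra.
  have le1 : S (J ord0) 0 <= S I 0 := left_ge ord0 x I hx' hI.
  have e : S I 0 = m%:Z * r%:Z - \sum_(i <- val I) (i : nat)%:Z.
    rewrite -(sum_const I) -sumrB; apply: eq_bigr => i _.
    by rewrite /sl muln0 (ends i).1; have := ltn_ord i; lia.
  move: le1 lt2; rewrite e; move: (S _ _) (m%:Z * r%:Z) (\sum_(i <- _) _) => s t y; lia.
have last_piece : 2 <= S (J ord_max) g.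
  rewrite leNgt; apply/negP => lt2.
  (* The weight [r - i] is the number of chips of [D_ i] at [v_{g+1}]. *)
  apply: (key ord_max (mid ord_max) (bridge_len L ord_max) (fun i => (r - i)%N%:Z)) => //.
  - by have := n0 ord_max; rewrite /mid; lra.
  - by have := n0 ord_max; rewrite /mid; lra.
  - move=> i j /eqP i0 /eqP j0; apply: val_inj; move: i0 j0.
    by have := ltn_ord i; have := ltn_ord j; rewrite /=; lia.
  move=> x I hx hI; have hx' : mid ord_max < x <= bridge_len L ord_max by lra.
  have le1 : S I g <= S (J ord_max) g := right_le ord_max x I hx' hI.
  have e : S I g = \sum_(i <- val I) (r - i)%N%:Z.
    by apply: eq_bigr => i _; rewrite /sl (ends i).2.
  move: le1 lt2; rewrite e; move: (S _ _) (\sum_(i <- _) _) => s y; lia.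
have loop_piece (k : 'I_g) : 2 <= m%:Z * (chip_pos D k != 0)%:Z
    + S (J (widen_ord (leqnSn g) k)) k - S (J (lift ord0 k)) k.+1.
  set k0 := widen_ord _ k; set k1 := lift ord0 k.
  have k1E : k1 = k.+1 :> nat by rewrite /= /bump /= add1n.
  rewrite leNgt; apply/negP => lt2.
  set N := S (J k0) k; have N0 : 0 <= N by apply: S_ge0; rewrite ltnW.
  (* [delta] is the slack in the first admissibility condition. On the last stretch of length [e]
     before the loop, a function of slope at most [N] rises by less than [delta]; the [1] in the
     denominator covers [N = 0]. *)
  pose delta := top_len L k - (4 * g)%:R * bot_len L k.
  have d0 : 0 < delta by rewrite subr_gt0.
  have NR : 0 <= N%:~R :> R by rewrite ler0z.
  pose e := delta / (N%:~R + 1).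
  have e0 : 0 < e by rewrite divr_gt0 //; lra.
  have Ne : N%:~R * e < delta.
    have -> : delta = (N%:~R + 1) * e by rewrite mulrC divfK // gt_eqF //; lra.
    by rewrite mulrDl mul1r; lra.
  set n := bridge_len L k0.
  have nk0 : 0 < n := n0 k0.
  apply: (key k0 (Num.max (mid k0) (n - e)) n (fun i => zdeg (2 * k + 2) (D_ i))).
  - by rewrite le_max /mid; apply/orP; left; have := n0 k0; lra.
  - by rewrite gt_max /mid -/n; lra.
  - exact: lexx.
  - by move=> i; exact: zdeg_ge0.
  - by move=> i j; exact: (zdeg_loop_D_eq0 redD avoid D_equiv D_ends deg_small small).
  move=> x I; rewrite gt_max => hx hI.
  have hx0 : mid k0 < x <= n by lra.
  have xn : 0 <= x <= n by move: hx0; rewrite /mid -/n; lra.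
  have le0 := right_le k0 x I hx0 hI.
  (* The weight of [I] is the degree of [D_I] on the loop, so it remains to control the slope of
     [psi I] on the next bridge. *)
  suff le1 : S (J k1) k.+1 <= S I k.+1.
    have -> : \sum_(i <- val I) zdeg (2 * k + 2) (D_ i) =
        S I k + m%:Z * (chip_pos D k != 0)%:Z - S I k.+1.
      rewrite -(sum_const I) -big_split -sumrB; apply: eq_bigr => i _.
      exact: (zdeg_loop_D_ redD avoid D_equiv D_ends deg_small small).
    by move: le0 lt2 le1; rewrite -/N /=; clear; lia.
  (* If [I] had a smaller slope than [J k1] on the next bridge, it would have to lie at least half
     of that bridge above [J k1] after the loop, since [J k1] is minimal at the middle. Before the
     loop it lies at most [N * e] above, and the loop adds at most [4 * g * bot_len]. The sum is
     below [top_len], hence below half of the bridge. *)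
  rewrite leNgt; apply/negP => ltS.
  have := loop_variation k (DI_eff I) (DI_eff (J k1)) (psiE I) (psiE (J k1)).
  rewrite -/k0 -/k1 DI_deg.
  set hI1 := psi I (w_ L k1); set hJ1 := psi (J k1) (w_ L k1).
  set hI0 := psi I (v_succ L k0); set hJ0 := psi (J k1) (v_succ L k0) => var.
  have FvE I' : F I' k0 n = psi I' (v_succ L k0) + b I' by rewrite /F edge_pt_tgt.
  have hm1 : 0 <= mid k1 <= bridge_len L k1 by have := n0 k1; rewrite /mid; lra.
  have Fm I' : F I' k1 (mid k1) = psi I' (w_ L k1) + (S I' k.+1)%:~R * mid k1 + b I'.
    by rewrite /F lin // k1E.
  have far : mid k1 <= hI1 + b I - (hJ1 + b (J k1)).
    have := minJ k1 I; rewrite !Fm -/hI1 -/hJ1.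
    have : (1 : R) <= (S (J k1) k.+1)%:~R - (S I k.+1)%:~R.
      by rewrite -rmorphB /= ler1z; move: ltS; clear; lia.
    by rewrite -(@ler_pM2r _ (mid k1)) ?divr_gt0 // mul1r; lra.
  have near : hI0 + b I - (hJ0 + b (J k1)) <= N%:~R * e.
    have := FvE I; have := FvE (J k1); rewrite -/hI0 -/hJ0 => <- <-.
    have nn : 0 <= n <= bridge_len L k0 by rewrite lexx ltW.
    rewrite !(FL _ k0 x n) //=; have := hI (J k1) => hIJ.
    have a1 : (S I k)%:~R * (n - x) <= N%:~R * (n - x).
      by apply: ler_wpM2r; [lra|rewrite ler_int].
    have a2 : N%:~R * (n - x) <= N%:~R * e by apply: ler_wpM2l => //; lra.
    have a3 : 0 <= (S (J k1) k)%:~R * (n - x).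
      by apply: mulr_ge0; [rewrite ler0z S_ge0 // ltnW|lra].
    by lra.
  have var' : hI1 - hJ1 - (hI0 - hJ0) <= (4 * g)%:R * bot_len L k.
    have p0 : 0 <= (4 * g)%:R * bot_len L k by rewrite mulr_ge0 // ltW // bot_len_gt0.
    case: var => var; first exact: le_trans p0.
    apply: le_trans var _; apply: le_trans (gm k).
    by rewrite ler_pM2r ?bot_len_gt0 // [X in _ <= X]pmulrn ler_int; move: md_small; clear; lia.
  have wide : 2 * top_len L k < bridge_len L k1.
    have := adm2 k; rewrite lt_min => /andP[_]; apply: le_lt_trans.
    by rewrite ler_pM2r ?top_len_gt0 // ler_nat; move: m1; clear; lia.
  by move: far near var' wide Ne; rewrite /mid /delta; clear; lra.
(* Adding the pieces from left to right, the slopes at inner middles cancel. At [n = g] the last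
   piece completes the bound to [2 * (g + 2) <= m * d]. *)
have total n (ng : (n < g.+1)%N) :
    2 * n.+1%:Z <= m%:Z * ldeg (2 * n) D - S (J (Ordinal ng)) n.
  elim: n ng => [|n IH] ng.
    rewrite (_ : Ordinal ng = ord0); last exact: val_inj.
    by rewrite ldeg0 (chip0 redD avoid D_equiv D_ends deg_small small) mulr1.
  have := IH (ltnW ng); have /= := loop_piece (Ordinal (ng : (n < g)%N)).
  have := ldeg_chip redD (Ordinal (ng : (n < g)%N)); rewrite /= => ->.
  rewrite (_ : widen_ord _ _ = Ordinal (ltnW ng)); last exact: val_inj.
  rewrite (_ : lift _ _ = Ordinal ng); last exact: val_inj.
  by rewrite mulrDr; move: (S _ _) (S _ _) => s s'; lia.
have := total g (ltnSn g); rewrite (_ : Ordinal _ = ord_max); last exact: val_inj.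
rewrite (ldeg_last redD) degD; move: last_piece mdd.
by move: (S _ _) (m%:Z * d) => s e; lia.
Qed.
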